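(* Let $\psi^{(i)}_{j,k}$ be the periodized wavelets on $\mathbb{T}^d=\mathbb{R}^d/\mathbb{Z}^d$ associated with an orthonormal $0$-smooth wavelet basis of $\mathbb{R}^d$ whose wavelets are continuous. Let $\chi$ be an unbounded random variable, and let $(j_n)_{n\ge1}$ be a divergence sequence associated with $\chi$. Then $$f=\sum_{n\ge 1}\frac{1}{n^{2}}\sum_{i,k}\psi^{(i)}_{j_n,k}$$ is a normally convergent wavelet series (and therefore $f$ is continuous). However its randomization $$X_f=\sum_{n\ge 1}\frac{1}{n^{2}}\sum_{i,k}\chi^{i}_{j_n,k}\,\psi^{(i)}_{j_n,k}$$ is almost surely nowhere locally bounded, where the $\chi^i_{j,k}$ are I.I.D. random variables of common law $\chi$.
   Context: An orthonormal $r$-smooth ($r\ge 0$) wavelet basis on $\mathbb{R}^d$ is a collection of functions $\varphi$ and $\Psi^{(i)}$, $i\in\{1,\dots,2^d-1\}$, such that: $\varphi$, the $\Psi^{(i)}$ and all their partial derivatives up to order $r$ have fast decay (faster than any negative power of $1+|x|$); and the functions $\varphi(\cdot-k)$, $k\in\mathbb{Z}^d$, together with $2^{dj/2}\Psi^{(i)}(2^j\cdot-k)$, $j\in\mathbb{N}$, $k\in\mathbb{Z}^d$, $i\in\{1,\dots,2^d-1\}$, form an orthonormal basis of $L^2(\mathbb{R}^d)$. The periodized wavelets on $\mathbb{T}^d$ are $\psi^{(i)}_{j,k}(x)=\sum_{l\in\mathbb{Z}^d}\Psi^{(i)}(2^j(x-l)-k)$, for $i\in\{1,\dots,2^d-1\}$,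 $j\in\mathbb{N}$, $k\in\mathbb{Z}^d$ with $2^{-j}k\in[0,1)^d$; at scale $j$, sums over $i,k$ run over these indices. A random variable $\chi$ is unbounded if $\mathbb{P}(|\chi|\ge A)>0$ for all $A>0$. A divergence sequence associated with $\chi$ is an increasing sequence of integers $(j_n)$ such that $\mathbb{P}(|\chi|\ge n^3)\ge 2^{-dj_n}$ for all $n$. A wavelet series $\sum_{i,j,k}c^i_{j,k}\psi^{(i)}_{j,k}$ is normally convergent if $\sum_j\sup_x\bigl(\sum_{i,k}|c^i_{j,k}|\,|\psi^{(i)}_{j,k}(x)|\bigr)<\infty$. Without further assumption on $\chi$, $X_f$ is a formal series. A (formal) wavelet series is nowhere locally bounded if there is no nonempty open set $U\subset\mathbb{T}^d$ such that its partial sums over scales $j\le J$ converge, as $J\to\infty$ and in the sense of distributions on $U$, to a function of $L^\infty(U)$. In particular, if the series converges in $L^2$, this means that its sum is not essentially bounded on any nonempty open set. *)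

(* Defs.v *)
From HB Require Import structures.
From mathcomp Require Import all_boot all_order all_algebra.
From mathcomp Require Import all_classical all_reals all_analysis.

Set Implicit Arguments.
Unset Strict Implicit.
Unset Printing Implicit Defensive.
Import Order.TTheory GRing.Theory Num.Theory.
Import numFieldNormedType.Exports.

Local Open Scope classical_set_scope.
Local Open Scope ring_scope.

Section rV_measurable.
Context {R : realType} {d : nat}.

Let coord (i : 'I_d) (x : 'rV[R]_d) : measurableTypeR R := x 0 i.

Let rV_set0 : g_sigma_preimage coord set0.
Proof. exact: sigma_algebra0. Qed.

Let rV_setC A : g_sigma_preimage coord A -> g_sigma_preimage coord (~` A).
Proof. exact: sigma_algebraC. Qed.

Let rV_bigcup (F : _^nat) : (forall i, g_sigma_preimage coord (F i)) ->
  g_sigma_preimage coord (\bigcup_i F i).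
Proof. exact: sigma_algebra_bigcup. Qed.

(* The sigma-algebra on R^d generated by the coordinates, i.e. the Borel sets. *)
HB.instance Definition _ := @isMeasurable.Build default_measure_display
  'rV[R]_d (g_sigma_preimage coord) rV_set0 rV_setC rV_bigcup.

Lemma measurable_coord (i : 'I_d) : measurable_fun [set: 'rV[R]_d] (coord i).
Proof.
move=> _ Y mY; rewrite setTI; apply: sub_sigma_algebra => /=.
rewrite -bigcup_seq/=; exists i => /=; first by rewrite mem_index_enum.
by exists Y => //; rewrite setTI.
Qed.

Lemma measurable_fun_rV d1 (T1 : measurableType d1) (f : T1 -> 'rV[R]_d) :
  (forall i, measurable_fun [set: T1] (coord i \o f)) ->
  measurable_fun [set: T1] f.
Proof.
move=> mf.
suff : g_sigma_preimage (fun i => coord i \o f) `<=` measurable.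
  rewrite g_sigma_preimage_comp => prefS _ A mA.
  by apply: prefS; exists A.
apply: smallest_sub; first exact: sigma_algebra_measurable.
rewrite -bigcup_seq => A [i _ [B mB <-]].
exact: mf.
Qed.

End rV_measurable.

Section sigma_finite_copy.
Context d (T : measurableType d) (R : realType).
Variables (m : {measure set T -> \bar R}) (sf : sigma_finite setT m).

Let mcopy : set T -> \bar R := fun A => let _ := sf in m A.

HB.instance Definition _ := Measure.copy mcopy m.
HB.instance Definition _ := Measure_isSigmaFinite.Build _ _ _ mcopy sf.

Definition sigma_finite_copy : {sigma_finite_measure set T -> \bar R} := mcopy.

End sigma_finite_copy.

Section lebesgue_rV.
Variable R : realType.

Definition rV_cons d (p : measurableTypeR R * 'rV[R]_d) : 'rV[R]_d.+1 :=
  \row_i (if unlift ord0 i is Some j then p.2 0 j else p.1).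

Lemma measurable_rV_cons d : measurable_fun setT (@rV_cons d).
Proof.
apply: measurable_fun_rV => i; case: (unliftP ord0 i) => [k|] ->.
  rewrite (_ : _ \o _ = (fun x : 'rV[R]_d => x 0 k : measurableTypeR R) \o snd).
    exact: measurableT_comp (measurable_coord k) measurable_snd.
  by apply/funext => p /=; rewrite mxE liftK.
rewrite (_ : _ \o _ = fst); first exact: measurable_fst.
by apply/funext => p /=; rewrite mxE unlift_none.
Qed.

(* Lebesgue measure on R^d, as the d-fold product of [lebesgue_measure]. *)
Fixpoint lebesgue_rV d : set 'rV[R]_d -> \bar R :=
  match d with
  | 0 => \d_(0 : 'rV[R]_0)
  | d'.+1 => pushforward (lebesgue_measure \x @lebesgue_rV d')%E (@rV_cons d')
  end.

Let box d (n : nat) : set 'rV[R]_d := [set x : 'rV[R]_d | forall i, `|x 0 i| <= n%:R].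

Let measurable_box d n : measurable (@box d n).
Proof.
rewrite (_ : @box d n = \bigcap_(i in [set: 'I_d])
    ((fun x : 'rV[R]_d => x 0 i : measurableTypeR R) @^-1` `[- n%:R, n%:R])).
  apply: fin_bigcap_measurable => [|i _]; first exact: finite_finset.
  by rewrite -[X in measurable X]setTI; apply: measurable_coord.
apply/seteqP; split => x /= Hx i; first move=> _.
  by rewrite /= in_itv/= -ler_norml.
by have := Hx i; rewrite /= in_itv/= -ler_norml; apply.
Qed.


Let box_sigma_finite d (m : {measure set 'rV[R]_d -> \bar R}) :
  (forall n, (m (@box d n) < +oo)%E) -> sigma_finite setT m.
Proof.
move=> mfin; exists (@box d).
  apply/esym; rewrite -subTset => x _.
  exists (Num.truncn (\sum_i `|x 0 i|)).+1 => // i.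
  apply/ltW/(le_lt_trans _ (truncnS_gt _)).
  by rewrite (bigD1 i)//= lerDl sumr_ge0.
by move=> n; split; [exact: measurable_box|exact: mfin].
Qed.

Let lebesgue_rV_spec d : exists2 m : {measure set 'rV[R]_d -> \bar R},
  @lebesgue_rV d = m & forall n, (m (@box d n) < +oo)%E.
Proof.
elim: d => [|d [m mE mfin]].
  exists (dirac (0 : 'rV[R]_0)) => // n.
  by rewrite /= diracE ltry.
have sf := box_sigma_finite mfin.
exists (measure_function_pushforward__canonical__measure_function_Measure
    (lebesgue_measure \x sigma_finite_copy sf)%E (@measurable_rV_cons d)).
  by rewrite /= mE.
move=> n.
pose I : set (measurableTypeR R) := `[- n%:R, n%:R]%classic.
have boxE : @rV_cons d @^-1` @box d.+1 n = I `*` @box d n.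
  apply/seteqP; split => [[x v] /= xv|[x v] [/= xn vn] i].
    split => [|i] /=.
      by have := xv ord0; rewrite mxE unlift_none /I/= in_itv/= -ler_norml.
    by have := xv (lift ord0 i); rewrite mxE liftK.
  rewrite mxE; case: unliftP => [k _|_]; first exact: vn.
  by move: xn; rewrite /I/= in_itv/= -ler_norml.
have : ((lebesgue_measure \x sigma_finite_copy sf) (I `*` @box d n) < +oo)%E.
  rewrite product_measure1E//=; [|exact: measurable_itv|exact: measurable_box].
  apply: lte_mul_pinfty; [by []| |exact: mfin].
  by rewrite /I lebesgue_measure_itv/=; case: ifP => _; rewrite -?EFinB.
by move=> lt; rewrite /= /pushforward boxE.
Qed.

Let lebesgue_rV0 d : @lebesgue_rV d set0 = 0%E.
Proof. by have [m -> _] := lebesgue_rV_spec d; exact: measure0. Qed.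

Let lebesgue_rV_ge0 d A : (0 <= @lebesgue_rV d A)%E.
Proof. by have [m -> _] := lebesgue_rV_spec d; exact: measure_ge0. Qed.

Let lebesgue_rV_sigma_additive d : semi_sigma_additive (@lebesgue_rV d).
Proof.
have [m -> _] := lebesgue_rV_spec d; exact: measure_semi_sigma_additive.
Qed.

HB.instance Definition _ d := isMeasure.Build _ _ _ (@lebesgue_rV d)
  (@lebesgue_rV0 d) (@lebesgue_rV_ge0 d) (@lebesgue_rV_sigma_additive d).

Let lebesgue_rV_sigma_finite d : sigma_finite setT (@lebesgue_rV d).
Proof.
have [m -> mfin] := lebesgue_rV_spec d.
exact: box_sigma_finite.
Qed.

HB.instance Definition _ d := Measure_isSigmaFinite.Build _ _ _ (@lebesgue_rV d)
  (@lebesgue_rV_sigma_finite d).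

End lebesgue_rV.
Arguments lebesgue_rV {R} d.

Section wavelets.
Context {R : realType} {d : nat}.
Implicit Types (f g : 'rV[R]_d -> R) (U : set 'rV[R]_d).

Definition latt (k : 'rV[int]_d) : 'rV[R]_d := map_mx intr k.

(* Sum of an absolutely summable family of reals indexed by Z^d. *)
Definition lattice_sum (a : 'rV[int]_d -> R) : R :=
  fine (\esum_(l in [set: 'rV[int]_d]) (EFin \o a)^\+ l
        - \esum_(l in [set: 'rV[int]_d]) (EFin \o a)^\- l)%E.

Definition partials (s : seq 'I_d) f : 'rV[R]_d -> R :=
  foldr (fun i g => 'D_(delta_mx 0 i) g) f s.

(* The norm of 'rV[R]_d is the max norm; being equivalent to the Euclidean one,
   it gives the same notion of fast decay. *)
Definition fast_decay f :=
  forall N : nat, exists C : R, forall x, `|f x| <= C * (1 + `|x|) ^- N.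

Definition fast_decay_upto (r : nat) f :=
  (forall s : seq 'I_d, (size s < r)%N ->
     forall i x, derivable (partials s f) x (delta_mx 0 i)) /\
  (forall s : seq 'I_d, (size s <= r)%N -> fast_decay (partials s f)).

Definition L2_orthonormal_basis (I : eqType) (e : I -> 'rV[R]_d -> R) :=
  [/\ forall a, e a \in Lfun (lebesgue_rV d) 2%:E,
      forall a b, \int[lebesgue_rV d]_x (e a x * e b x) = (a == b)%:R &
      forall f, f \in Lfun (lebesgue_rV d) 2%:E -> forall eps : R, 0 < eps ->
        exists (s : seq I) (c : I -> R),
          ('N[lebesgue_rV d]_2%:E
             [EFin \o (fun x => f x - \sum_(a <- s) c a * e a x)%R] < eps%:E)%E].

Definition wavelet_family (phi : 'rV[R]_d -> R)
    (Psi : 'I_(2 ^ d).-1 -> 'rV[R]_d -> R)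
    (a : 'rV[int]_d + nat * 'I_(2 ^ d).-1 * 'rV[int]_d) : 'rV[R]_d -> R :=
  match a with
  | inl k => fun x => phi (x - latt k)
  | inr (j, i, k) =>
      fun x => 2 `^ ((d * j)%:R / 2) * Psi i (2 ^+ j *: x - latt k)
  end.

Definition smooth_wavelet_basis (r : nat) (phi : 'rV[R]_d -> R)
    (Psi : 'I_(2 ^ d).-1 -> 'rV[R]_d -> R) :=
  [/\ fast_decay_upto r phi, forall i, fast_decay_upto r (Psi i) &
      L2_orthonormal_basis (wavelet_family phi Psi)].

(* Functions on the torus R^d/Z^d are Z^d-periodic functions on R^d, and, by
   definition of the quotient topology, open subsets of the torus are
   Z^d-periodic open subsets of R^d. *)
Definition Zd_periodic (T : Type) (f : 'rV[R]_d -> T) :=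
  forall x l, f (x + latt l) = f x.

Definition torus_open U := open U /\ Zd_periodic U.

Definition unit_cube : set 'rV[R]_d :=
  [set x : 'rV[R]_d | forall i, 0 <= x 0 i < 1].

Definition periodized (Psi : 'I_(2 ^ d).-1 -> 'rV[R]_d -> R) (j : nat)
    (i : 'I_(2 ^ d).-1) (k : 'rV[int]_d) (x : 'rV[R]_d) : R :=
  lattice_sum (fun l => Psi i (2 ^+ j *: (x - latt l) - latt k)).

(* The k in Z^d with 2^-j k in [0, 1)^d are those in {0, ..., 2^j - 1}^d. *)
Definition int_of_position j (k : 'rV['I_(2 ^ j)]_d) : 'rV[int]_d :=
  map_mx (fun a : 'I_(2 ^ j) => (a : nat)%:Z) k.

Definition wavelet_coefs :=
  forall j : nat, 'I_(2 ^ d).-1 -> 'rV['I_(2 ^ j)]_d -> R.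

Definition scale_sum (Psi : 'I_(2 ^ d).-1 -> 'rV[R]_d -> R)
    (c : wavelet_coefs) (j : nat) (x : 'rV[R]_d) : R :=
  \sum_i \sum_k c j i k * periodized Psi j i (int_of_position k) x.

Definition partial_sum (Psi : 'I_(2 ^ d).-1 -> 'rV[R]_d -> R)
    (c : wavelet_coefs) (J : nat) (x : 'rV[R]_d) : R :=
  \sum_(j < J.+1) scale_sum Psi c j x.

Definition series_sum (Psi : 'I_(2 ^ d).-1 -> 'rV[R]_d -> R)
    (c : wavelet_coefs) (x : 'rV[R]_d) : R :=
  limn (fun J => partial_sum Psi c J x).

Definition normally_convergent (Psi : 'I_(2 ^ d).-1 -> 'rV[R]_d -> R)
    (c : wavelet_coefs) :=
  (\sum_(0 <= j <oo) ereal_sup (range (fun x : 'rV[R]_d =>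
     (\sum_i \sum_k `|c j i k| * `|periodized Psi j i (int_of_position k) x|)%:E))
   < +oo)%E.

Definition smooth f := forall s : seq 'I_d,
  (forall i x, derivable (partials s f) x (delta_mx 0 i)) /\
  continuous (partials s f).

(* The torus is compact, so closed supports are automatically compact. *)
Definition test_function U (theta : 'rV[R]_d -> R) :=
  [/\ Zd_periodic theta, smooth theta &
      closure [set x : 'rV[R]_d | theta x != 0] `<=` U].

(* Integrals over the torus are integrals over the unit cube. *)
Definition distribution_cvg U (S : nat -> 'rV[R]_d -> R) g :=
  forall theta, test_function U theta ->
    \int[lebesgue_rV d]_(x in unit_cube) (S J x * theta x) @[J --> \oo] -->
    \int[lebesgue_rV d]_(x in unit_cube `&` U) (g x * theta x).

Definition nowhere_locally_bounded (Psi : 'I_(2 ^ d).-1 -> 'rV[R]_d -> R)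
    (c : wavelet_coefs) :=
  ~ exists U : set 'rV[R]_d, [/\ U !=set0, torus_open U &
      exists g, [/\ Zd_periodic g, g \_ U \in Lfun (lebesgue_rV d) +oo%E &
        distribution_cvg U (partial_sum Psi c) g]].

(* The family [c^i_{j,k} = 1/n^2] if [j = j_n] for some [n >= 1] (a unique one
   when [j_n] is strictly increasing), and [0] at the other scales. *)
Definition lacunary_coefs (jn : nat -> nat) : wavelet_coefs :=
  fun j i k => \sum_(n \in [set n | (0 < n)%N /\ jn n = j]) (n%:R : R) ^- 2.

End wavelets.
Arguments wavelet_coefs : clear implicits.
Arguments lacunary_coefs {R d} jn j i k.

Section random.
Context {R : realType}.

Definition unbounded_rv d (T : measurableType d) (P : probability T R)
    (chi : T -> R) :=
  forall A : R, 0 < A -> (0 < P [set w | (A <= `|chi w|)%R])%E.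

Definition divergence_sequence (dim : nat) d (T : measurableType d)
    (P : probability T R) (chi : T -> R) (jn : nat -> nat) :=
  (forall m n, (0 < m)%N -> (m < n)%N -> (jn m < jn n)%N) /\
  (forall n, (0 < n)%N ->
     ((2 ^- (dim * jn n))%:E <= P [set w | (n%:R ^+ 3 <= `|chi w|)%R])%E).

Definition mutually_independent d (T : measurableType d) (P : probability T R)
    (I : eqType) (X : I -> T -> R) :=
  forall s : seq I, uniq s -> forall A : I -> set R,
    (forall i, measurable (A i)) ->
    P (\bigcap_(i in [set` s]) (X i @^-1` A i)) =
      (\prod_(i <- s) P (X i @^-1` A i))%E.

Definition same_law d1 (T1 : measurableType d1) (P1 : probability T1 R)
    d2 (T2 : measurableType d2) (P2 : probability T2 R)
    (X1 : {RV P1 >-> R}) (X2 : {RV P2 >-> R}) :=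
  forall A : set R, measurable A -> distribution P1 X1 A = distribution P2 X2 A.

Definition wavelet_index dim :=
  {j : nat & ('I_(2 ^ dim).-1 * 'rV['I_(2 ^ j)]_dim)%type}.

Definition iid_copies (dim : nat) d0 (T0 : measurableType d0)
    (P0 : probability T0 R) (chi : {RV P0 >-> R})
    d (T : measurableType d) (P : probability T R)
    (X : forall j : nat, 'I_(2 ^ dim).-1 -> 'rV['I_(2 ^ j)]_dim ->
      {RV P >-> R}) :=
  (forall j i k, same_law (X j i k) chi) /\
  mutually_independent P (fun a : wavelet_index dim =>
    X (tag a) (tagged a).1 (tagged a).2 : T -> R).

End random.

(* Main.v *)
(* The random series is tested against finitely many bumps supported in a small
   ball of the torus. Let [A] be the indices [(j_n, i0, k)], [N <= n < N + L],
   whose cube lies well inside the ball. Two families of coefficients on [A]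
   giving nearly the same pairings differ, at scale [j_n], by at most a constant
   times [n^2]: pair the difference of the two sums on R^d with the wavelet
   carrying the largest weighted coefficient, whose mass outside the ball
   is small. So, conditionally on all other coefficients, boundedness of the
   pairings confines each of the [chi_a], [a] in [A], to an interval of length
   [O(n^2)]. Since [n^2] is negligible compared with [n^3], such an interval
   has probability at most [1 - 2^(-d j_n)]. There are at least [2^(d (j_n - m))]
   independent coefficients for each [n], so that the product of these bounds is
   at most [exp (- 2^(-d m)) ^ L], and [L] is arbitrary. *)

Require Import Defs.
From HB Require Import structures.
From mathcomp Require Import all_boot all_order all_algebra.
From mathcomp Require Import all_classical all_reals all_analysis.
From mathcomp Require Import measurable_realfun ess_sup_inf.
From mathcomp Require Import ring lra.
Import Order.TTheory GRing.Theory Num.Theory.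
Import numFieldNormedType.Exports.
Local Open Scope classical_set_scope.
Local Open Scope ring_scope.
Set Implicit Arguments.
Unset Strict Implicit.
Unset Printing Implicit Defensive.

(** * Integrals and weights on R^d *)

(** The bound on the coefficients of [A] closes by absorption. With [Mx] the largest weighted
    difference, the error of replacing point values by finitely many pairings and the error of
    leaving the ball are both proportional to [Mx]; each is made at most [Mx / 4] and moved to the
    left-hand side. The constant that remains depends on the bound [M], on [d] and on the decay of
    [Psi], but neither on [A] nor on the tests. This keeps the choices from being circular: the
    threshold for small intervals depends on that constant alone, then [N] is taken large in terms
    of [L], then the tests in terms of [A], and only then the truncation [J], whose other
    coefficients are arbitrary. Leaving the ball costs a factor [L], not the number of indices,
    because the wavelets of one scale have a bounded absolute sum; the decay at distance
    [2 ^+ (jn n - m)] beats it. Pairing over R^d is possible because translating a wavelet by a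
    period gives another member of the same orthogonal system. Countably many dyadic balls and
    integer bounds [M] stand for all open sets and all bounded limits. *)

Section prod_integral.
Context {R : realType}.

Lemma measurable_prod_coord d (f : 'I_d -> R -> R) :
  (forall i, measurable_fun setT (f i)) ->
  measurable_fun setT (fun x : 'rV[R]_d => \prod_i f i (x 0 i)).
Proof.
move=> mf.
apply: measurable_prod => i _.
exact: measurableT_comp (mf i) (measurable_coord i).
Qed.

(** Tonelli, by induction on [d]: in dimension [d.+1] the measure is the image under [rV_cons] of a
    product measure, so the first factor splits off. *)
Lemma integral_prod_coord d (f : 'I_d -> R -> R) :
  (forall i, measurable_fun setT (f i)) -> (forall i t, 0 <= f i t) ->
  (\int[lebesgue_rV d]_x (\prod_i f i (x 0 i))%:E
   = \prod_i \int[lebesgue_measure]_t (f i t)%:E)%E.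
Proof.
elim: d f => [|d IH] f mf f0.
  rewrite big_ord0 /=.
  under eq_integral do rewrite big_ord0.
  by rewrite integral_cst//= mul1e; exact: diracT.
have prod0 n (g : 'I_n -> R -> R) (g0 : forall i t, 0 <= g i t) (x : 'rV[R]_n) :
  0 <= \prod_i g i (x 0 i) by apply: prodr_ge0.
rewrite /= ge0_integral_pushforward//=; last 3 first.
- exact: measurable_rV_cons.
- by apply/measurable_EFinP; exact: measurable_prod_coord.
- by move=> x _; rewrite lee_fin; apply: prodr_ge0.
rewrite preimage_setT.
have -> : (\int[lebesgue_measure \x lebesgue_rV d]_x
   ((fun x : 'rV[R]_d.+1 => (\prod_i f i (x 0 i))%:E) \o @rV_cons R d) x =
   \int[lebesgue_measure \x lebesgue_rV d]_x
   ((f ord0 x.1)%:E * (\prod_i f (lift ord0 i) (x.2 0 i))%:E))%E.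
  apply: eq_integral => -[t v] _ /=.
  rewrite big_ord_recl EFinM mxE unlift_none; congr (_ * _%:E)%E.
  by apply: eq_bigr => i _; rewrite mxE liftK.
have mF : measurable_fun setT (fun x : measurableTypeR R * 'rV[R]_d =>
    ((f ord0 x.1)%:E * (\prod_i f (lift ord0 i) (x.2 0 i))%:E)%E).
  apply: emeasurable_funM; apply/measurable_EFinP.
    by apply: measurableT_comp (mf ord0) _; exact: measurable_fst.
  pose h (v : 'rV[R]_d) := \prod_i f (lift ord0 i) (v 0 i).
  have mh : measurable_fun setT h := measurable_prod_coord (fun i => mf (lift ord0 i)).
  exact: measurableT_comp mh measurable_snd.
rewrite fubini_tonelli1//; last first.
  by move=> x; rewrite -EFinM lee_fin; apply: mulr_ge0 => //; apply: prodr_ge0.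
rewrite big_ord_recl -IH// -ge0_integralZr//; first last.
- by apply: integral_ge0 => v _; rewrite lee_fin; apply: prodr_ge0.
- by move=> t _; rewrite lee_fin.
- by apply/measurable_EFinP; exact: (mf ord0).
apply: eq_integral => t _; rewrite /fubini_F /=.
rewrite ge0_integralZl//; last 2 first.
- by move=> v _; rewrite lee_fin; apply: prodr_ge0.
- by rewrite lee_fin.
by apply/measurable_EFinP; exact: (measurable_prod_coord (fun i => mf (lift ord0 i))).
Qed.

(** The antiderivative [2 ^- a * atan (2 ^+ a * t - b)] varies by at most [pi * 2 ^- a] on any
    interval; monotone convergence along [[-n, n]] passes to the whole line. *)
Lemma integral_oneDsqrV_le (a : nat) (b : R) :
  (\int[lebesgue_measure]_t ((1 + (2 ^+ a * t - b) ^+ 2)^-1)%:E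
    <= (pi * 2 ^- a)%:E)%E.
Proof.
pose F (t : R) := 2 ^- a * atan (2 ^+ a * t - b).
have a0 : (0 : R) < 2 ^+ a by rewrite exprn_gt0.
pose f (t : R) : R := (1 + (2 ^+ a * t - b) ^+ 2)^-1.
have f0 t : 0 <= f t by rewrite invr_ge0 addr_ge0// sqr_ge0.
have cf : continuous f.
  move=> t; apply: cvgV; first by rewrite gt_eqF// ltr_pwDl// sqr_ge0.
  apply: cvgD; first exact: cvg_cst.
  apply: cvgM; (apply: cvgD; [apply: cvgM; [exact: cvg_cst|exact: cvg_id]|exact: cvg_cst]).
have mf : measurable_fun setT f by exact: continuous_measurable_fun.
have dF (t : R) : is_derive t (1:R) F (f t).
  have -> : f t = 2 ^- a *: ((1 + (2 ^+ a * t - b) ^+ 2)^-1 * (2 ^+ a)).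
    by rewrite /f /GRing.scale/= mulrCA mulVf ?gt_eqF// mulr1.
  have -> : F = 2 ^- a \*: (atan \o (fun u => 2 ^+ a * u - b) : R -> R) by [].
  apply: is_deriveZ.
  apply: (@is_derive1_comp _ atan (fun u => 2 ^+ a * u - b)).
  have -> : (fun u : R => 2 ^+ a * u - b) = (2 ^+ a \*: id : R -> R) - cst b by [].
  by apply: is_derive_eq; rewrite subr0 /GRing.scale/= mulr1.
pose I (n : nat) : set (measurableTypeR R) := `[- n%:R, n%:R]%classic.
have -> : (\int[lebesgue_measure]_t (f t)%:E =
   \int[lebesgue_measure]_(t in \bigcup_n I n) (f t)%:E)%E.
  congr (integral _ _ _); apply/esym; rewrite -subTset => t _.
  exists (Num.truncn `|t|).+1 => //; rewrite /I/= in_itv/= -ler_norml.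
  exact/ltW/truncnS_gt.
have cvgI := @ge0_nondecreasing_set_cvg_integral _ _ R
  I (fun t => (f t)%:E) lebesgue_measure.
have {}cvgI : (\int[lebesgue_measure]_(t in I n) (f t)%:E)%E @[n --> \oo] -->
    (\int[lebesgue_measure]_(t in \bigcup_n I n) (f t)%:E)%E.
  apply: cvgI.
  + apply/nondecreasing_seqP => n; apply/subsetPset => t /=; rewrite /I /= !in_itv/= => /andP[h1 h2].
    by rewrite (le_trans _ h1) ?(le_trans h2)// ?lerN2 ler_nat.
  + by move=> n; exact: measurable_itv.
  + by move=> n; apply/measurable_EFinP; exact: measurable_funTS.
  + by move=> n t _; rewrite lee_fin.
rewrite -(cvg_lim _ cvgI)//; apply: lime_le; first exact: cvgP cvgI.
near=> n.
  rewrite /I (@continuous_FTC2 _ f F)//.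
- rewrite -EFinB lee_fin /F -mulrBr mulrC ler_pM2r ?invr_gt0//.
    have := atan_ltpi2 (2 ^+ a * n%:R - b); have := atan_gtNpi2 (2 ^+ a * - n%:R - b).
    by move=> ? ?; rewrite [pi]splitr; lra.
- by rewrite gtrN // ltr0n; near: n; exact: nbhs_infty_gt.
- exact: continuous_subspaceT.
- split.
  + by move=> t _; apply: ex_derive.
  + apply: cvg_at_right_filter; apply/differentiable_continuous/derivable1_diffP.
      exact: ex_derive.
  + apply: cvg_at_left_filter; apply/differentiable_continuous/derivable1_diffP.
      exact: ex_derive.
- by move=> t _; rewrite derive1E; exact: derive_val.
Unshelve. all: by end_near. Qed.
End prod_integral.

Section weight.
Context {R : realType}.

Definition floor_mx d (x : 'rV[R]_d) : 'rV[int]_d := map_mx Num.floor x.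

Lemma ler_coord_norm d (x : 'rV[R]_d) i : `|x 0 i| <= `|x|.
Proof.
rewrite [leRHS]mx_normrE.
exact: (le_bigmax _ (fun i : 'I_1 * 'I_d => `|x i.1 i.2|) (0, i)).
Qed.

Lemma rV_norm_le d (x : 'rV[R]_d) e : 0 <= e -> (forall i, `|x 0 i| <= e) -> `|x| <= e.
Proof.
by move=> e0 xe; rewrite [leLHS]mx_normrE; apply: bigmax_le => // -[i j] _; rewrite ord1.
Qed.

(** The sigma-algebra is generated by the coordinates, so open sets are not measurable by
    definition. Rounding down to the grid [2 ^- n] Z^d makes [f \o q n] take countably many values,
    on measurable cells, and continuity gives pointwise convergence to [f]. *)
Lemma continuous_rV_measurable d (f : 'rV[R]_d -> R) :
  continuous f -> measurable_fun setT f.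
Proof.
move=> cf.
pose q n (x : 'rV[R]_d) : 'rV[R]_d := 2 ^- n *: latt (floor_mx (2 ^+ n *: x)).
apply: (@measurable_fun_cvg _ _ _ _ (fun n => f \o q n)) => [n|x _].
  move=> _ B mB; rewrite setTI.
  have -> : (f \o q n) @^-1` B = \bigcup_(k : 'rV[int]_d)
     (if `[< B (f (2 ^- n *: latt k)) >]
      then [set x | floor_mx (2 ^+ n *: x) = k] else set0).
    apply/seteqP; split => [x Bx|x [k _]] /=.
      by exists (floor_mx (2 ^+ n *: x)) => //; case: asboolP.
    by case: asboolP => //= Bk xk; rewrite /q xk.
  apply: countable_bigcupT_measurable => [|k]; first exact: countableP.
  case: asboolP => // _.
  have -> : [set x : 'rV[R]_d | floor_mx (2 ^+ n *: x) = k] =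
     \bigcap_(i in [set: 'I_d]) ((fun x : 'rV[R]_d => x 0 i : measurableTypeR R) @^-1`
       [set t | (k 0 i)%:~R <= 2 ^+ n * t < (k 0 i + 1)%:~R]).
    apply/seteqP; split => [x /= <- i _|x /= xk].
      by rewrite !mxE /= -[_ * _]/(_ * _) floor_itv.
    by apply/rowP => i; rewrite !mxE; apply: floor_def; exact: xk.
  apply: fin_bigcap_measurable => [|i _]; first exact: finite_finset.
  rewrite -[X in measurable X]setTI; apply: measurable_coord => //.
  have -> : [set t : R | (k 0 i)%:~R <= 2 ^+ n * t < (k 0 i + 1)%:~R] =
     `[(k 0 i)%:~R / 2 ^+ n, (k 0 i + 1)%:~R / 2 ^+ n[%classic.
    apply/seteqP; split => t /=; rewrite in_itv/=.
      by rewrite ler_pdivrMr ?exprn_gt0// ltr_pdivlMr ?exprn_gt0// ![t * _]mulrC.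
    by rewrite ler_pdivrMr ?exprn_gt0// ltr_pdivlMr ?exprn_gt0// ![t * _]mulrC.
  exact: measurable_itv.
have qx : q n x @[n --> \oo] --> x.
  apply/cvgrPdist_le => e e0.
  near=> n.
  apply: rV_norm_le => [|i]; first exact: ltW.
  rewrite /q !mxE; set t := x 0 i.
  have p0 : (0 : R) < 2 ^+ n by rewrite exprn_gt0.
  have /andP[] := floor_itv (2 ^+ n * t); set z := Num.floor _ => z1 z2.
  rewrite intrD in z2.
  have -> : t - 2 ^- n * z%:~R = 2 ^- n * (2 ^+ n * t - z%:~R).
    by rewrite mulrBr mulrA mulVf ?gt_eqF// mul1r.
  have n1 : 2 ^- n <= e.
    rewrite invf_ple ?posrE ?exprn_gt0 ?invr_gt0//.
    have : e^-1 <= n%:R.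
      apply: le_trans (ltW (truncnS_gt _)) _; rewrite ler_nat.
      by near: n; exact: nbhs_infty_ge.
    move/le_trans; apply; rewrite -natrX ler_nat.
    exact/ltnW/ltn_expl.
  rewrite normrM gtr0_norm ?invr_gt0// -[e]mulr1 ler_pM ?invr_ge0 ?(ltW p0)//.
  rewrite ger0_norm; lra.
exact: (cvg_comp (fun n => q n x) f qx (cf x)).
Unshelve. all: by end_near. Qed.

(* Integrable, summable over the lattice, and a product over the coordinates, so
   that its integrals reduce to one-dimensional ones. *)
Definition weight d (y : 'rV[R]_d) : R := \prod_i (1 + y 0 i ^+ 2)^-1.

Lemma weight_ge0 d (y : 'rV[R]_d) : 0 <= weight y.
Proof. by apply: prodr_ge0 => i _; rewrite invr_ge0 addr_ge0// sqr_ge0. Qed.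

Let oneDsqr_gt0 (t : R) : 0 < 1 + t ^+ 2.
Proof. by rewrite ltr_pwDl// sqr_ge0. Qed.

Lemma weight_affineE d j (b x : 'rV[R]_d) :
  weight (2 ^+ j *: x - b) =
  \prod_i (1 + (2 ^+ j * x 0 i - b 0 i) ^+ 2)^-1.
Proof. by apply: eq_bigr => i _; rewrite !mxE. Qed.

Let measurable_oneDsqrV (a b : R) :
  measurable_fun setT (fun t : R => (1 + (a * t - b) ^+ 2)^-1).
Proof.
apply: continuous_measurable_fun => t.
apply: cvgV; first by rewrite gt_eqF.
apply: cvgD; first exact: cvg_cst.
apply: cvgM; (apply: cvgD; [apply: cvgM; [exact: cvg_cst|exact: cvg_id]|exact: cvg_cst]).
Qed.

Lemma measurable_weight_affine d j (b : 'rV[R]_d) :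
  measurable_fun setT (fun x : 'rV[R]_d => weight (2 ^+ j *: x - b)).
Proof.
under eq_fun do rewrite weight_affineE.
exact: (measurable_prod_coord (f := fun i t => (1 + (2 ^+ j * t - b 0 i) ^+ 2)^-1)).
Qed.

Let lee_prod_ord n (a b : 'I_n -> \bar R) : (forall i, 0 <= a i)%E ->
  (forall i, a i <= b i)%E -> (\prod_i a i <= \prod_i b i)%E.
Proof.
move=> a0 ab.
suff [] : (0%E <= \prod_i a i /\ \prod_i a i <= \prod_i b i)%E by [].
elim/big_ind2: _ => [|x1 x2 y1 y2 [? ?] [? ?]|i _] //.
by split; [exact: mule_ge0|exact: lee_pmul].
Qed.

Lemma integral_weight_affine_le d j (b : 'rV[R]_d) :
  (\int[lebesgue_rV d]_x (weight (2 ^+ j *: x - b))%:E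
    <= (pi ^+ d * 2 ^- (d * j))%:E)%E.
Proof.
under eq_integral do rewrite weight_affineE.
rewrite (@integral_prod_coord _ _ (fun i t => (1 + (2 ^+ j * t - b 0 i) ^+ 2)^-1))//.
  2: by move=> i t; rewrite invr_ge0 ltW.
have -> : (pi ^+ d * 2 ^- (d * j) : R)%:E = (\prod_(i < d) (pi * 2 ^- j : R)%:E)%E.
  by rewrite prodEFin prodr_const card_ord exprMn exprVn mulnC exprM.
apply: lee_prod_ord => i; last exact: integral_oneDsqrV_le.
by apply: integral_ge0 => t _; rewrite lee_fin invr_ge0 ltW.
Qed.

(** Of the [2 * d + 1] powers of [1 + |x|], two per coordinate pay for [weight], since
    [1 + x_i ^+ 2 <= (1 + |x|) ^+ 2]. The last one is kept apart: it later makes the mass of a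
    wavelet far from its centre small. *)
Lemma fast_decay_weight d (f : 'rV[R]_d -> R) : fast_decay f ->
  exists2 C : R, 0 <= C & forall x, `|f x| <= C * weight x / (1 + `|x|).
Proof.
move=> /(_ (2 * d).+1)%N [C fC].
have C0 : 0 <= C.
  have := fC 0; rewrite normr0 addr0 expr1n invr1 mulr1.
  exact: le_trans.
exists C => // x; apply: le_trans (fC x) _.
have x0 : 0 < 1 + `|x| by rewrite ltr_pwDl.
rewrite exprSr invfM mulrA ler_wpM2r ?invr_ge0 ?(ltW x0)//.
rewrite ler_wpM2l// exprM -exprVn -[d in _ ^+ d]card_ord -prodr_const.
apply: ler_prod => i _; rewrite invr_ge0 exprn_ge0 ?(ltW x0)//=.
rewrite lef_pV2 ?posrE ?exprn_gt0//.
have xi := ler_coord_norm x i.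
rewrite -[x 0 i ^+ 2]real_normK ?num_real//.
have := normr_ge0 (x 0 i); nra.
Qed.

(** A Peetre-type inequality, coordinate by coordinate. It provides a summable majorant that is
    uniform for [y] in a ball. *)
Lemma weightB_le d (y t : 'rV[R]_d) (r : R) : `|y| <= r ->
  weight (y - t) <= (2 * (1 + r ^+ 2)) ^+ d * weight t.
Proof.
move=> yr; rewrite /weight -[d in _ ^+ d]card_ord -prodr_const -big_split/=.
apply: ler_prod => i _; rewrite invr_ge0 ltW//= !mxE.
have yi : `|y 0 i| <= r := le_trans (ler_coord_norm y i) yr.
have yi2 : y 0 i ^+ 2 <= r ^+ 2.
  by rewrite -[y 0 i ^+ 2]real_normK ?num_real// ler_sqr ?nnegrE// (le_trans _ yi).
rewrite ler_pdivlMr// mulrC ler_pdivrMr//.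
set a := y 0 i in yi2 *; set b := t 0 i.
have : 0 <= (a - b) ^+ 2 * r ^+ 2 by rewrite mulr_ge0 ?sqr_ge0.
have := sqr_ge0 (a - (a - b) * 2); nra.
Qed.

Let cell d (k : 'rV[int]_d) (x : 'rV[R]_d) : R :=
  \prod_i \1_(`[(k 0 i)%:~R, (k 0 i + 1)%:~R[ : set R) (x 0 i).

Let cellE d (k : 'rV[int]_d) x : cell k x = (k == floor_mx x)%:R.
Proof.
have [->|kx] := eqVneq k (floor_mx x).
  rewrite /cell big1// => i _; rewrite indicE mem_set//=.
  by rewrite in_itv/= mxE floor_itv.
have /existsP [i ki] : [exists i, k 0 i != floor_mx x 0 i].
  apply: contraNT kx; rewrite negb_exists => /forallP h.
  by apply/eqP/rowP => i; apply/eqP; rewrite -[_ == _]negbK h.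
apply/eqP; rewrite /cell prodf_seq_eq0; apply/hasP; exists i; first exact: mem_index_enum.
rewrite indicE memNset//= in_itv/= => /floor_def xk.
by move: ki; rewrite mxE xk eqxx.
Qed.

(** Comparison with an integral: on the unit cell at [k], each factor of [weight (y - k)] is at most
    3 times the corresponding factor of [weight (x - y)]. The cells being disjoint, the sum is at
    most [3 ^+ d] times the integral of [weight]. *)
Lemma sum_weight_latt_le d (s : seq 'rV[int]_d) (y : 'rV[R]_d) : uniq s ->
  \sum_(k <- s) weight (y - latt k) <= (3 * pi) ^+ d.
Proof.
move=> us.
(* The trivial dilation [2 ^+ 0] puts the integrand in the form of the lemmas on affine weights. *)
pose g (k : 'rV[int]_d) (i : 'I_d) t : R := \1_(`[(k 0 i)%:~R, (k 0 i + 1)%:~R[ : set R) t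
   * (3 * (1 + (2 ^+ 0 * t - y 0 i) ^+ 2)^-1).
have mg (k : 'rV[int]_d) i : measurable_fun setT (g k i).
  apply: measurable_funM; first exact: measurable_indic.
  exact: measurable_funM.
have g0 (k : 'rV[int]_d) i t : 0 <= g k i t.
  by rewrite mulr_ge0// mulr_ge0// invr_ge0 ltW.
have gE k (x : 'rV[R]_d) : \prod_i g k i (x 0 i) = 3 ^+ d * (k == floor_mx x)%:R * weight (2 ^+ 0 *: x - y).
  rewrite /g !big_split/= -/(cell k x) cellE prodr_const card_ord weight_affineE.
  by rewrite mulrA [_%:R * _]mulrC.
rewrite -lee_fin -sumEFin.
apply: (@le_trans _ _ (\sum_(k <- s) \int[lebesgue_rV d]_x (\prod_i g k i (x 0 i))%:E)%E).
  apply: lee_sum => k _; rewrite integral_prod_coord// -prodEFin.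
  apply: lee_prod_ord => i; first by rewrite lee_fin invr_ge0 ltW.
  rewrite !mxE; set c : R := _^-1; set I : set (measurableTypeR R) := `[(k 0 i)%:~R, (k 0 i + 1)%:~R[%classic.
  have c0 : 0 <= c by rewrite invr_ge0 ltW.
  have muI : lebesgue_measure I = 1%E.
    rewrite /I lebesgue_measure_itv/= lte_fin ltr_int ltzD1 lexx.
    by rewrite -EFinB intrD [_ + 1]addrC addrK.
  have -> : c%:E = (\int[lebesgue_measure]_t (c%:E * (\1_I t)%:E))%E.
    rewrite ge0_integralZl_EFin//; last first.
      by apply/measurable_EFinP/measurable_indic; exact: measurable_itv.
    rewrite integral_indic//; last exact: measurable_itv.
    by rewrite setIT [X in (_ * X)%E](_ : _ = 1%E) ?mule1.
  apply: ge0_le_integral => //.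
  - by move=> t _; rewrite -EFinM lee_fin mulr_ge0.
  - apply/measurable_EFinP; apply: measurable_funM => //.
    by apply: measurable_indic; exact: measurable_itv.
  - by apply/measurable_EFinP; exact: mg.
  move=> t _; rewrite -EFinM lee_fin /g indicE mulrC.
  have [tI|_] := boolP (t \in I); last by rewrite !mul0r.
  rewrite !mul1r.
  move: tI; rewrite inE /I/= in_itv/= intrD => /andP[t1 t2].
  rewrite ler_pdivlMr// /c mulrC ler_pdivrMr//.
  set u := y 0 i; set v := (k 0 i)%:~R in t1 t2 *.
  have := sqr_ge0 (u - v + (t - v)); have : (t - v) ^+ 2 <= 1.
    by rewrite expr_le1//; lra.
  by have := sqr_ge0 (u - v); lra.
rewrite -ge0_integral_sum//; last 2 first.
- by move=> k; apply/measurable_EFinP; exact: measurable_prod_coord.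
- by move=> k x _; rewrite lee_fin; apply: prodr_ge0.
apply: (@le_trans _ _ (\int[lebesgue_rV d]_x ((3 ^+ d)%:E * (weight (2 ^+ 0 *: x - y))%:E))%E).
  apply: ge0_le_integral => //.
  - by move=> x _; apply: sume_ge0 => k _; rewrite lee_fin; apply: prodr_ge0.
  - apply: emeasurable_sum => k; apply/measurable_EFinP; exact: measurable_prod_coord.
  - apply/measurable_EFinP/measurable_funM => //; exact: measurable_weight_affine.
  move=> x _; rewrite sumEFin -EFinM lee_fin.
  under eq_bigr do rewrite gE.
  rewrite -mulr_suml ler_wpM2r ?weight_ge0// -mulr_sumr ler_piMr//.
  rewrite -natr_sum lern1.
  have -> : (\sum_(k <- s) (k == floor_mx x) = \sum_(k <- s | k == floor_mx x) 1)%N.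
    by rewrite [RHS]big_mkcond.
  by rewrite sum1_count count_uniq_mem// leq_b1.
rewrite ge0_integralZl//; last 2 first.
- by apply/measurable_EFinP; exact: measurable_weight_affine.
- by move=> x _; rewrite lee_fin weight_ge0.
rewrite exprMn EFinM lee_pmul2l//.
apply: le_trans (integral_weight_affine_le _ _) _.
by rewrite muln0 expr0 invr1 mulr1.
Qed.

End weight.

(** * Absolutely summable families over Z^d *)

Section lattice_sum.
Context {R : realType} {d : nat}.
Implicit Types a : 'rV[int]_d -> R.

(** An exhaustion of Z^d by finite duplicate-free lists, through the countable encoding; it turns
    lattice sums into limits of sequences. *)
Definition latt_enum N : seq 'rV[int]_d := pmap pickle_inv (iota 0 N).

Lemma latt_enum_uniq N : uniq (latt_enum N).
Proof.
rewrite /latt_enum; apply: (@pmap_uniq _ _ pickle_inv pickle).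
  exact: pickle_invK.
exact: iota_uniq.
Qed.

Lemma mem_latt_enum l N : (pickle l < N)%N -> l \in latt_enum N.
Proof.
move=> lN; rewrite mem_pmap; apply/mapP; exists (pickle l).
  by rewrite mem_iota.
by rewrite pickleK_inv.
Qed.

Let seqn a n : R := if pickle_inv n is Some l then a l else 0.

Let sum_seqn a N : \sum_(0 <= n < N) seqn a n = \sum_(l <- latt_enum N) a l.
Proof.
rewrite /index_iota subn0 /latt_enum; elim: (iota 0 N) => [|n s ih].
  by rewrite !big_nil.
rewrite big_cons /= ih /seqn; case: pickle_inv => [l|] /=.
  by rewrite big_cons.
by rewrite add0r.
Qed.

Let esum_seqn (a : 'rV[int]_d -> R) : (forall l, 0 <= a l) ->
  (\esum_(l in [set: 'rV[int]_d]) (a l)%:E = \sum_(0 <= n <oo) (seqn a n)%:E)%E.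
Proof.
move=> a0; rewrite nneseries_esumT; last first.
  by move=> n; rewrite lee_fin /seqn; case: pickle_inv.
have -> : (\esum_(l in [set: 'rV[int]_d]) (a l)%:E =
    \esum_(l in [set: 'rV[int]_d]) (seqn a (pickle l))%:E)%E.
  by apply: eq_esum => l _; rewrite /seqn pickleK_inv.
rewrite -(@esum_image _ _ _ setT (@pickle 'rV[int]_d) (fun n => (seqn a n)%:E)); last first.
  by move=> x y _ _; exact: (pcan_inj pickleK).
rewrite esum_mkcond; apply: eq_esum => n _; case: ifPn => // nP.
rewrite /seqn; case E : pickle_inv => [l|//].
have := @pickle_invK 'rV[int]_d n; rewrite E /= => nl.
by move: nP; rewrite notin_setE => /=; case; exists l.
Qed.

Lemma lattice_sum_cvg a B : (forall s, uniq s -> \sum_(l <- s) `|a l| <= B) ->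
  \sum_(l <- latt_enum N) a l @[N --> \oo] --> lattice_sum a.
Proof.
move=> aB.
have cvg0 (b : 'rV[int]_d -> R) : (forall l, 0 <= b l) -> (forall l, b l <= `|a l|) ->
  \sum_(l <- latt_enum N) b l @[N --> \oo] -->
    fine (\esum_(l in [set: 'rV[int]_d]) (b l)%:E) /\
  (\esum_(l in [set: 'rV[int]_d]) (b l)%:E \is a fin_num)%E.
  move=> b0 ba.
  have cb : cvgn (fun N => \sum_(l <- latt_enum N) b l).
    apply: nondecreasing_is_cvgn.
      apply/nondecreasing_seqP => n; rewrite -!sum_seqn big_nat_recr//= lerDl /seqn.
      by case: pickle_inv.
    exists B => _ [n _ <-]; apply: le_trans (aB _ (latt_enum_uniq n)).
    exact: ler_sum.
  have E : (\esum_(l in [set: 'rV[int]_d]) (b l)%:E =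
      (limn (fun N => \sum_(l <- latt_enum N) b l))%:E)%E.
    rewrite esum_seqn//; apply/cvg_lim => //.
    under eq_fun do rewrite sumEFin sum_seqn.
    by apply/cvg_EFin; [near=> n|].
  by rewrite E.
have [||cp fp] := cvg0 (a^\+) => [l|l|].
- exact: funrpos_ge0.
- by rewrite -[leRHS]/((Num.norm \o a) l) -funrposDneg lerDl funrneg_ge0.
have [||cn fn] := cvg0 (a^\-) => [l|l|].
- exact: funrneg_ge0.
- by rewrite -[leRHS]/((Num.norm \o a) l) -funrposDneg lerDr funrpos_ge0.
rewrite /lattice_sum funerpos funerneg.
rewrite fineB//.
have -> : (fun N => \sum_(l <- latt_enum N) a l) =
  (fun N => \sum_(l <- latt_enum N) a^\+ l) \- (fun N => \sum_(l <- latt_enum N) a^\- l).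
  apply/funext => N /=; rewrite -sumrB; apply: eq_bigr => l _.
  by rewrite -[in LHS](funrposBneg a).
exact: cvgB.
Unshelve. all: by end_near. Qed.

Lemma lattice_sum_norm_le a B : (forall s, uniq s -> \sum_(l <- s) `|a l| <= B) ->
  `|lattice_sum a| <= B.
Proof.
move=> aB; have c := lattice_sum_cvg aB.
rewrite -(cvg_lim _ (cvg_norm c))//.
apply: limr_le; first exact: cvgP (cvg_norm c).
by apply: nearW => N; apply: le_trans (ler_norm_sum _ _ _) _; apply/aB/latt_enum_uniq.
Qed.

(** The truncation [N] is chosen from the majorant [b] alone, so it serves all dominated families at
    once. This uniformity is what makes periodized wavelets continuous. *)
Lemma lattice_sum_tail_le (b : 'rV[int]_d -> R) B e :
  (forall s, uniq s -> \sum_(l <- s) b l <= B) -> 0 < e ->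
  exists N, forall a, (forall l, `|a l| <= b l) ->
    `|lattice_sum a - \sum_(l <- latt_enum N) a l| <= e.
Proof.
move=> bB e0.
(* If [b] is negative somewhere, it dominates no family. *)
have [b0|] := pselect (forall l, 0 <= b l); last first.
  move=> /existsNP[l bl]; exists 0%N => a ab; exfalso; apply: bl.
  exact: le_trans (normr_ge0 _) (ab l).
have bnB s : uniq s -> \sum_(l <- s) `|b l| <= B.
  by move=> us; under eq_bigr do rewrite ger0_norm//; exact: bB.
have seqn0 n : 0 <= seqn b n by rewrite /seqn; case: pickle_inv.
have cb := lattice_sum_cvg bnB.
have nd : nondecreasing_seq (fun N => \sum_(l <- latt_enum N) b l).
  by apply/nondecreasing_seqP => n; rewrite -!sum_seqn big_nat_recr//= lerDl.
have [N _ /(_ N (leqnn N)) NP] : \forall N \near \oo,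
    `|lattice_sum b - \sum_(l <- latt_enum N) b l| <= e by move/cvgrPdist_le : cb; exact.
exists N => a ab.
have ca : \sum_(l <- latt_enum n) a l @[n --> \oo] --> lattice_sum a.
  apply: (@lattice_sum_cvg _ B) => s us.
  by apply: le_trans (bB _ us); apply: ler_sum => l _; exact: ab.
have {}ca : `|\sum_(l <- latt_enum n) a l - \sum_(l <- latt_enum N) a l| @[n --> \oo]
    --> `|lattice_sum a - \sum_(l <- latt_enum N) a l|.
  by apply: cvg_norm; apply: cvgB => //; exact: cvg_cst.
rewrite -(cvg_lim _ ca)//; apply: limr_le; first exact: cvgP ca.
near=> n; apply: le_trans NP.
have Nn : (N <= n)%N by near: n; exact: nbhs_infty_ge.
rewrite -!sum_seqn (big_cat_nat _ Nn)//= [_ + _ - _]addrC addKr.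
apply: le_trans (ler_norm_sum _ _ _) _.
apply: (@le_trans _ _ (\sum_(N <= i < n) seqn b i)).
  by apply: ler_sum => i _; rewrite /seqn; case: pickle_inv => // ; rewrite normr0.
apply: le_trans (ler_norm _); rewrite lerBrDl.
have -> : \sum_(0 <= i < N) seqn b i + \sum_(N <= i < n) seqn b i =
    \sum_(l <- latt_enum n) b l by rewrite -sum_seqn [RHS](big_cat_nat _ Nn).
rewrite -(cvg_lim _ cb)//; apply: nondecreasing_cvgn_le => //; exact: cvgP cb.
Unshelve. all: by end_near. Qed.

End lattice_sum.

Section approx.
Context {R : realType}.

(** The argument with three thirds of [e]; the approximation is asked only near [x], which suits
    estimates that are locally uniform. *)
Lemma cvg_approx (T : topologicalType) (f : T -> R) x :
  (forall e, 0 < e -> exists2 g : T -> R, {for x, continuous g} &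
     \forall y \near x, `|f y - g y| <= e) -> {for x, continuous f}.
Proof.
move=> fg; apply/cvgrPdist_le => e e0.
have e3 : 0 < e / 3 by rewrite divr_gt0.
have [g cg gf] := fg _ e3.
have fgx : `|f x - g x| <= e / 3 by exact: nbhs_singleton gf.
move/cvgrPdist_le : cg => /(_ _ e3) cg.
near=> y.
have h1 : `|g x - g y| <= e / 3 by near: y.
have h2 : `|f y - g y| <= e / 3 by near: y.
have -> : f x - f y = (f x - g x) + (g x - g y) - (f y - g y) by ring.
apply: le_trans (ler_normB _ _) _; apply: le_trans (lerD (ler_normD _ _) (lexx _)) _.
lra.
Unshelve. all: by end_near. Qed.

Lemma continuous_sum_fun (T : topologicalType) (I : Type) (s : seq I) (f : I -> T -> R) x :
  (forall i, {for x, continuous (f i)}) ->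
  {for x, continuous (fun y => \sum_(i <- s) f i y)}.
Proof.
move=> cf; elim: s => [|i s ih].
  rewrite (_ : (fun _ => _) = cst 0); first exact: cvg_cst.
  by apply/funext => y; rewrite big_nil.
rewrite (_ : (fun _ => _) = f i \+ (fun y => \sum_(i <- s) f i y)).
  by apply: cvgD; [exact: cf|exact: ih].
by apply/funext => y; rewrite big_cons.
Qed.

Lemma continuous_affine (V : normedModType R) (c : R) (a b : V) :
  continuous (fun y => c *: (y - a) - b).
Proof.
move=> x; apply: cvgB; last exact: cvg_cst.
by apply: cvgZr; apply: cvgB; [exact: cvg_id|exact: cvg_cst].
Qed.

End approx.

Lemma weightN (R : realType) d (x : 'rV[R]_d) : weight (- x) = weight x.
Proof. by apply: eq_bigr => i _; rewrite mxE sqrrN. Qed.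

Lemma lattice_sum_shift (R : realType) d (a : 'rV[int]_d -> R) m :
  lattice_sum (fun l => a (l - m)) = lattice_sum a.
Proof.
have bij : set_bij [set: 'rV[int]_d] [set: 'rV[int]_d] (fun l => l - m).
  split => //.
  - by move=> x y _ _; exact: subIr.
  - by move=> x _ /=; exists (x + m) => //; rewrite addrK.
congr (fine (_ - _)).
  rewrite [RHS](reindex_esum setT setT (fun l : 'rV[int]_d => l - m) ((EFin \o a)^\+)%E bij).
  by apply: eq_esum => l _; rewrite !funeposE.
rewrite [RHS](reindex_esum setT setT (fun l : 'rV[int]_d => l - m) ((EFin \o a)^\-)%E bij).
by apply: eq_esum => l _; rewrite !funenegE.
Qed.

Lemma scale_shift_inj d j k : injective (fun l : 'rV[int]_d => k + 2 ^+ j *: l).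
Proof.
move=> l l' /addrI ll'; apply/rowP => i; move/rowP : ll' => /(_ i).
by rewrite !mxE; apply: mulfI; rewrite expf_neq0.
Qed.

(** Uniqueness of Euclidean division by [2 ^+ j]. Hence positions [k] and periods [l] together run
    through lattice points without repetition. *)
Lemma int_of_position_shift_inj d j (k k' : 'rV['I_(2 ^ j)]_d) l l' :
  int_of_position k + 2 ^+ j *: l = int_of_position k' + 2 ^+ j *: l' ->
  k = k' /\ l = l'.
Proof.
move=> kl; have kk' : k = k'.
  apply/rowP => c; move/rowP : kl => /(_ c); rewrite !mxE => /(congr1 (modz^~ (2 ^+ j))).
  rewrite ![2 ^+ j * _]mulrC ![_ + _ * _]addrC !modzMDl -[2]/(2%N%:Z) -rmorphXn/=.
  by rewrite !modz_nat !modn_small// => -[/val_inj].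
by split => //; rewrite -kk' in kl; exact: scale_shift_inj kl.
Qed.

Lemma integrable_sum_EFin d' (T : measurableType d') (R : realType)
    (mu : {measure set T -> \bar R}) D (I : Type) (s : seq I) (f : I -> T -> R) :
  measurable D -> (forall i, mu.-integrable D (EFin \o f i)) ->
  mu.-integrable D (fun x => (\sum_(i <- s) f i x)%:E).
Proof.
move=> mD fi; under eq_fun do rewrite -sumEFin.
by apply: integrable_sum => // i _; exact: fi.
Qed.

Lemma Rintegral_sum d' (T : measurableType d') (R : realType)
    (mu : {measure set T -> \bar R}) D (I : Type) (s : seq I) (f : I -> T -> R) :
  measurable D -> (forall i, mu.-integrable D (EFin \o f i)) ->
  \int[mu]_(x in D) (\sum_(i <- s) f i x) = \sum_(i <- s) \int[mu]_(x in D) f i x.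
Proof.
move=> mD fi; elim: s => [|i s ih].
  by under eq_Rintegral do rewrite big_nil; rewrite big_nil Rintegral_cst// mul0r.
under eq_Rintegral do rewrite big_cons.
by rewrite RintegralD// ?ih ?big_cons//; exact: integrable_sum_EFin.
Qed.

Lemma weight_le1 (R : realType) d (x : 'rV[R]_d) : weight x <= 1.
Proof.
apply: prodr_ile1 => i _; have x0 := sqr_ge0 (x 0 i).
by rewrite invr_ge0 invf_le1 ?lerDl ?ltr_pwDl// addr_ge0.
Qed.

Lemma integrable_weight (R : realType) d j (b : 'rV[R]_d) :
  (lebesgue_rV d).-integrable setT (fun x => (weight (2 ^+ j *: x - b))%:E).
Proof.
apply/integrableP; split.
  by apply/measurable_EFinP; exact: measurable_weight_affine.
apply: le_lt_trans (ltry (pi ^+ d * 2 ^- (d * j))).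
apply: le_trans _ (integral_weight_affine_le j b).
by under eq_integral do rewrite abse_EFin ger0_norm ?weight_ge0//.
Qed.

Lemma integrable_weight_affine (R : realType) d j (b : 'rV[R]_d) c :
  (lebesgue_rV d).-integrable setT (fun x => (c * weight (2 ^+ j *: x - b))%:E).
Proof.
by under eq_fun do rewrite EFinM; apply: integrableZl => //; exact: integrable_weight.
Qed.

Lemma Rintegral_weight_affine_le (R : realType) d j (b : 'rV[R]_d) c : 0 <= c ->
  \int[lebesgue_rV d]_x (c * weight (2 ^+ j *: x - b)) <= c * (pi ^+ d * 2 ^- (d * j)).
Proof.
move=> c0; have iw := integrable_weight j b.
rewrite RintegralZl// ler_wpM2l// -lee_fin fineK; last exact: integrable_fin_num.
exact: integral_weight_affine_le.
Qed.

(** * Periodized wavelets *)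

Section periodized.
Context {R : realType} {d : nat}.
Variable Psi : 'I_(2 ^ d).-1 -> 'rV[R]_d -> R.
Variable C : R.
Hypothesis C0 : 0 <= C.
Hypothesis PsiC : forall i x, `|Psi i x| <= C * weight x / (1 + `|x|).
Hypothesis Psi_continuous : forall i, continuous (Psi i).

Lemma Psi_weight i x : `|Psi i x| <= C * weight x.
Proof.
apply: le_trans (PsiC i x) _.
have x1 : 0 < 1 + `|x| by rewrite ltr_pwDl.
by rewrite ler_pdivrMr// ler_peMr ?lerDl// mulr_ge0// weight_ge0.
Qed.

Lemma scale_shiftE j (k l : 'rV[int]_d) (x : 'rV[R]_d) :
  2 ^+ j *: (x - latt l) - latt k = 2 ^+ j *: x - latt (k + 2 ^+ j *: l).
Proof.
apply/rowP => i; rewrite !mxE intrD intrM rmorphXn/=.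
rewrite mulrBr opprD addrA addrAC; congr (_ - _ - _).
Qed.

Lemma sum_Psi_le j i k (x : 'rV[R]_d) s : uniq s ->
  \sum_(l <- s) `|Psi i (2 ^+ j *: (x - latt l) - latt k)| <= C * (3 * pi) ^+ d.
Proof.
move=> us.
apply: (@le_trans _ _ (\sum_(t <- [seq k + 2 ^+ j *: l | l <- s])
    C * weight (2 ^+ j *: x - latt t))).
  rewrite big_map; apply: ler_sum => l _; rewrite scale_shiftE.
  exact: Psi_weight.
rewrite -mulr_sumr ler_wpM2l// sum_weight_latt_le// map_inj_uniq//.
exact: scale_shift_inj.
Qed.

Lemma periodized_cvg j i k (x : 'rV[R]_d) :
  \sum_(l <- latt_enum N) Psi i (2 ^+ j *: (x - latt l) - latt k) @[N --> \oo]
   --> periodized Psi j i k x.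
Proof. exact: (lattice_sum_cvg (fun s => @sum_Psi_le j i k x s)). Qed.

Lemma continuous_periodized j i k : continuous (periodized Psi j i k).
Proof.
move=> x; apply: cvg_approx => e e0.
(* [r] bounds the norm of [2 ^+ j *: y] for every [y] within distance 1 of [x]. *)
pose r := 2 ^+ j * (`|x| + 1).
pose b l := C * (2 * (1 + r ^+ 2)) ^+ d * weight (0 - latt (k + 2 ^+ j *: l)) : R.
have bB s : uniq s -> \sum_(l <- s) b l <= C * (2 * (1 + r ^+ 2)) ^+ d * (3 * pi) ^+ d.
  move=> us; rewrite /b -mulr_sumr ler_wpM2l//.
    by rewrite mulr_ge0// exprn_ge0// mulr_ge0// addr_ge0// sqr_ge0.
  rewrite -(big_map (fun l => k + 2 ^+ j *: l) xpredT (fun t => weight (0 - latt t))).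
  by rewrite sum_weight_latt_le// map_inj_uniq//; exact: scale_shift_inj.
have [N NP] := lattice_sum_tail_le bB e0.
exists (fun y => \sum_(l <- latt_enum N) Psi i (2 ^+ j *: (y - latt l) - latt k)).
  apply: continuous_sum_fun => l.
  apply: continuous_comp; last exact: Psi_continuous.
  exact: (@continuous_affine _ 'rV[R]_d).
near=> y; apply: NP => l; rewrite scale_shiftE.
apply: le_trans (Psi_weight _ _) _.
rewrite /b -mulrA ler_wpM2l// sub0r.
apply: le_trans (weightB_le (y := 2 ^+ j *: y) (r := r) _ _) _.
  rewrite normrZ ger0_norm ?exprn_ge0// /r ler_wpM2l ?exprn_ge0//.
  have : `|x - y| <= 1 by near: y; apply: cvgr_dist_le => //; exact: cvg_id.
  by move=> xy; rewrite -[y](subrK x) (le_trans (ler_normD _ _))// addrC lerD2l distrC.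
by rewrite weightN.
Unshelve. all: by end_near. Qed.

Lemma periodized_periodic j i k : Zd_periodic (periodized Psi j i k).
Proof.
move=> x m.
pose a l := Psi i (2 ^+ j *: (x - latt l) - latt k).
have aE l : Psi i (2 ^+ j *: (x + latt m - latt l) - latt k) = a (l - m).
  congr (Psi _ (_ *: _ - _)); apply/rowP => c; rewrite !mxE rmorphB/=.
  by rewrite opprB addrA addrAC.
rewrite /periodized; under eq_fun do rewrite aE.
exact: lattice_sum_shift.
Qed.

(** Expanding every periodization gives a double sum over [k] and [l] whose lattice points are
    distinct, so a single lattice sum of [weight] bounds it. The bound does not depend on [j],
    although the number of positions does. *)
Lemma sum_periodized_le j i (x : 'rV[R]_d) :
  \sum_(k : 'rV['I_(2 ^ j)]_d) `|periodized Psi j i (int_of_position k) x|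
    <= C * (3 * pi) ^+ d.
Proof.
pose u (N : nat) := \sum_(k : 'rV['I_(2 ^ j)]_d)
  `|\sum_(l <- latt_enum N) Psi i (2 ^+ j *: (x - latt l) - latt (int_of_position k))|.
have cu : u N @[N --> \oo] -->
    \sum_(k : 'rV['I_(2 ^ j)]_d) `|periodized Psi j i (int_of_position k) x|.
  rewrite /u; elim: (index_enum _) => [|k s ih].
    by under eq_fun do rewrite big_nil; rewrite big_nil; exact: cvg_cst.
  under eq_fun do rewrite big_cons.
  by rewrite big_cons; apply: cvgD => //; apply: cvg_norm; exact: periodized_cvg.
rewrite -(cvg_lim _ cu)//; apply: limr_le; first exact: cvgP cu.
apply: nearW => N; rewrite /u.
pose s := [seq int_of_position k + 2 ^+ j *: l | k <- index_enum 'rV['I_(2 ^ j)]_d, l <- latt_enum N].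
apply: (@le_trans _ _ (\sum_(t <- s) C * weight (2 ^+ j *: x - latt t))).
  rewrite big_allpairs_dep; apply: ler_sum => k _.
  apply: le_trans (ler_norm_sum _ _ _) _; apply: ler_sum => l _.
  by rewrite scale_shiftE; exact: Psi_weight.
rewrite -mulr_sumr ler_wpM2l// sum_weight_latt_le//.
apply: allpairs_uniq.
- exact: index_enum_uniq.
- exact: latt_enum_uniq.
move=> [k l] [k' l'] _ _ /= kl.
by have [-> ->] := int_of_position_shift_inj kl.
Qed.

Lemma measurable_Psi i j k :
  measurable_fun setT (fun x : 'rV[R]_d => Psi i (2 ^+ j *: x - latt k)).
Proof.
apply: continuous_rV_measurable => x.
rewrite -[x]subr0; under eq_fun do rewrite -[X in 2 ^+ j *: X](subr0).
apply: continuous_comp; last exact: Psi_continuous.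
exact: (@continuous_affine _ 'rV[R]_d).
Qed.

Lemma integrable_Psi_bounded i j k (g : 'rV[R]_d -> R) B : 
  measurable_fun setT g -> (forall x, `|g x| <= B) ->
  (lebesgue_rV d).-integrable setT
    (fun x : 'rV[R]_d => (g x * Psi i (2 ^+ j *: x - latt k))%:E).
Proof.
move=> mg gB.
apply: le_integrable (integrable_weight_affine j (latt k) (B * C)) => //.
  by apply/measurable_EFinP; apply: measurable_funM => //; exact: measurable_Psi.
move=> x _; rewrite !abse_EFin lee_fin [leRHS]ger0_norm; last first.
  by rewrite !mulr_ge0 ?weight_ge0// (le_trans _ (gB x)).
by rewrite normrM -mulrA ler_pM// Psi_weight.
Qed.

Variable phi : 'rV[R]_d -> R.
Hypothesis Psi_basis : L2_orthonormal_basis (wavelet_family phi Psi).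

(** Orthonormality with the normalizing factors [2 ^ (d j / 2)] divided out. *)
Lemma Rintegral_PsiPsi j i k j' i' k' :
  \int[lebesgue_rV d]_x (Psi i (2 ^+ j *: x - latt k) * Psi i' (2 ^+ j' *: x - latt k'))
  = ((j, i, k) == (j', i', k'))%:R * 2 ^- (d * j').
Proof.
have [_ orth _] := Psi_basis.
have := orth (inr (j, i, k)) (inr (j', i', k')).
rewrite (inj_eq (@inr_inj _ _)) /= => H.
pose c (j : nat) : R := 2 `^ ((d * j)%:R / 2).
have {}H : (c j * c j') * (\int[lebesgue_rV d]_x (Psi i (2 ^+ j *: x - latt k) * Psi i' (2 ^+ j' *: x - latt k'))) = ((j, i, k) == (j', i', k'))%:R.
  rewrite -RintegralZl//.
    by rewrite -H; apply: eq_Rintegral => x _; rewrite /c; ring.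
  apply: (@integrable_Psi_bounded _ _ _ _ C); first exact: measurable_Psi.
  move=> x; apply: le_trans (Psi_weight _ _) _.
  by rewrite ler_piMr// weight_le1.
have cc : c j' * c j' = 2 ^+ (d * j').
  rewrite /c -powRD; last by rewrite pnatr_eq0 implybT.
  by rewrite -splitr powR_mulrn.
have c0 : c j != 0 by rewrite gt_eqF// powR_gt0.
have c0' : c j' != 0 by rewrite gt_eqF// powR_gt0.
move: H; have [[-> _ _]|_] := eqVneq.
  by rewrite cc mul1r => /(canRL (mulKf _)) ->; rewrite ?mulr1// expf_neq0.
by move=> /eqP; rewrite !mulf_eq0 (negbTE c0) (negbTE c0')/= => /eqP ->; rewrite mul0r.
Qed.

Definition psi (a : wavelet_index d) : 'rV[R]_d -> R :=
  periodized Psi (tag a) (tagged a).1 (int_of_position (tagged a).2).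

(** The single term [l = 0] of the periodization, localized in R^d; [psi] is paired with it over the
    whole space. *)
Definition psi_line (a : wavelet_index d) (x : 'rV[R]_d) : R :=
  Psi (tagged a).1 (2 ^+ tag a *: x - latt (int_of_position (tagged a).2)).

Lemma measurable_psi a : measurable_fun setT (psi a).
Proof. by apply: continuous_rV_measurable; exact: continuous_periodized. Qed.

Lemma normr_psi_le a x : `|psi a x| <= C * (3 * pi) ^+ d.
Proof. by apply: lattice_sum_norm_le => s us; exact: sum_Psi_le. Qed.

(** [psi a] is a sum of wavelets at the positions [k + 2 ^+ j *: l], and the one of index [b] occurs
    among them only if [a = b], at [l = 0]. Dominated convergence exchanges the sum and the
    integral. *)
Lemma Rintegral_psi_line a b :
  \int[lebesgue_rV d]_x (psi a x * psi_line b x) = (a == b)%:R * 2 ^- (d * tag b).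
Proof.
case: a b => j [i k] [j' [i' k']] /=.
pose S N (x : 'rV[R]_d) := \sum_(l <- latt_enum N) Psi i (2 ^+ j *: (x - latt l) - latt (int_of_position k)).
pose p : 'rV[R]_d -> R := psi_line (existT _ j' (i', k')).
have mS N : measurable_fun setT (S N).
  apply: measurable_sum => l; under eq_fun do rewrite scale_shiftE; exact: measurable_Psi.
have SB N x : `|S N x| <= C * (3 * pi) ^+ d.
  apply: le_trans (ler_norm_sum _ _ _) _.
  exact/sum_Psi_le/latt_enum_uniq.
have cvgI : (\int[lebesgue_rV d]_x (S N x * p x)%:E)%E @[N --> \oo] -->
    (\int[lebesgue_rV d]_x (psi (existT _ j (i, k)) x * p x)%:E)%E.
  apply: (@dominated_cvg _ _ _ _ _ measurableT (fun N x => (S N x * p x)%:E) _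
     (fun x => (C * (3 * pi) ^+ d * C * weight (2 ^+ j' *: x - latt (int_of_position k')))%:E)) => //.
  - move=> N; apply/measurable_EFinP; apply: measurable_funM => //; exact: measurable_Psi.
  - move=> x _; apply: cvg_EFin; first by near=> N.
    by apply: (@cvgM _ _ _ _ (S^~ x) (cst (p x))); [exact: periodized_cvg|exact: cvg_cst].
  - exact: integrable_weight_affine.
  - move=> N x _; rewrite abse_EFin lee_fin normrM -mulrA ler_pM//.
    exact: Psi_weight.
have intS N : (lebesgue_rV d).-integrable setT (fun x => (S N x * p x)%:E).
  exact: integrable_Psi_bounded (SB N).
suff cvgI' : (\int[lebesgue_rV d]_x (S N x * p x)%:E)%E @[N --> \oo] -->
    (((existT _ j (i, k) : wavelet_index d) == existT _ j' (i', k'))%:R * 2 ^- (d * j'))%:E.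
  by rewrite /Rintegral (cvg_unique _ cvgI cvgI').
(* The integrals are constant as soon as the enumeration has reached the period 0. *)
apply: cvg_near_cst; near=> N.
rewrite -[LHS]fineK; last exact: integrable_fin_num.
congr EFin; rewrite -/(Rintegral _ _ _).
rewrite /S; under eq_Rintegral do rewrite mulr_suml.
rewrite Rintegral_sum//; last first.
  move=> l; under eq_fun do rewrite /= scale_shiftE.
  apply: (integrable_Psi_bounded _ _ _ (B := C)); first exact: measurable_Psi.
  by move=> x; apply: le_trans (Psi_weight _ _) _; rewrite ler_piMr// weight_le1.
have E l : \int[lebesgue_rV d]_x (Psi i (2 ^+ j *: (x - latt l) - latt (int_of_position k)) * p x) =
    ((j, i, int_of_position k + 2 ^+ j *: l) == (j', i', int_of_position k'))%:R * 2 ^- (d * j').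
  by rewrite -Rintegral_PsiPsi; apply: eq_Rintegral => x _; rewrite scale_shiftE.
rewrite (eq_bigr _ (fun l _ => E l)) -mulr_suml; congr (_ * _).
have [jj'|jj'] := eqVneq j j'; last first.
  rewrite [RHS](_ : _ = 0) ?big1//.
    by move=> l _; rewrite !xpair_eqE (negbTE jj').
  by rewrite -[X in _ = X]/(0%:R) -tag_eqE /tag_eq/= (negbTE jj').
case: _ / jj' in k' p cvgI intS E *; rewrite eq_Tagged/= xpair_eqE.
under eq_bigr do rewrite !xpair_eqE eqxx/=.
have [_|ii'] := eqVneq i i'; last by rewrite big1.
have kE l : (int_of_position k + 2 ^+ j *: l == int_of_position k') = (k == k') && (l == 0).
  apply/eqP/andP => [|[/eqP-> /eqP->]]; last by rewrite scaler0 addr0.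
  rewrite -{1}[int_of_position k']addr0 -{1}(scaler0 _ (2 ^+ j)).
  by move=> /int_of_position_shift_inj [-> ->]; rewrite !eqxx.
under eq_bigr do rewrite kE.
have [_|kk'] := eqVneq k k'; last by rewrite big1.
rewrite -natr_sum; congr (_%:R).
apply: (@etrans _ _ (count_mem 0 (latt_enum N))).
  by rewrite -sum1_count [in RHS]big_mkcond.
rewrite count_uniq_mem ?latt_enum_uniq// mem_latt_enum//.
by near: N; exact: nbhs_infty_gt.
Unshelve. all: by end_near. Qed.

(* Pairing the sum with [psi_line a0] over the whole of R^d, rather than pairing
   over the torus, isolates the coefficient of [a0] by orthogonality. *)
Lemma coef_bound (A : seq (wavelet_index d)) (beta : wavelet_index d -> R) a0 (M D rho : R) :
  uniq A -> a0 \in A -> 0 <= D -> 0 <= rho ->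
  (forall x, `|\sum_(a <- A) beta a * psi a x| <= M) ->
  (forall x, `|\sum_(a <- A) beta a * psi a x| <= D \/
     rho <= `|2 ^+ tag a0 *: x - latt (int_of_position (tagged a0).2)|) ->
  `|beta a0| <= (D + M / (1 + rho)) * (C * pi ^+ d).
Proof.
move=> uA a0A D0 rho0 DM DD.
set Delta := (fun x => \sum_(a <- A) beta a * psi a x) in DM DD.
have rho1 : 0 < 1 + rho by rewrite ltr_pwDl.
have M0 : 0 <= M := le_trans (normr_ge0 _) (DM 0).
have mDelta : measurable_fun setT Delta.
  by apply: measurable_sum => a; apply: measurable_funM => //; exact: measurable_psi.
have intE : \int[lebesgue_rV d]_x (Delta x * psi_line a0 x) = beta a0 * 2 ^- (d * tag a0).
  rewrite /Delta; under eq_Rintegral do rewrite mulr_suml.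
  have ib a : (lebesgue_rV d).-integrable setT (fun x => (psi a x * psi_line a0 x)%:E).
    by apply: (integrable_Psi_bounded _ _ _ (B := C * (3 * pi) ^+ d)) => [|x]; [exact: measurable_psi|exact: normr_psi_le].
  have Ea a : \int[lebesgue_rV d]_x (beta a * psi a x * psi_line a0 x) =
      beta a * ((a == a0)%:R * 2 ^- (d * tag a0)).
    rewrite -Rintegral_psi_line; under eq_Rintegral do rewrite -mulrA.
    by apply: RintegralZl => //; exact: ib.
  rewrite Rintegral_sum//.
    rewrite (bigD1_seq a0)//= [X in _ + X]big1 ?addr0 => [|a aa0].
      by rewrite Ea eqxx mul1r.
    by rewrite Ea (negbTE aa0) mul0r mulr0.
  move=> a; rewrite (_ : EFin \o _ = (fun x => (beta a)%:E * (psi a x * psi_line a0 x)%:E)%E).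
    exact: integrableZl.
  by apply/funext => x /=; rewrite -EFinM mulrA.
have p0 : (0 : R) < 2 ^- (d * tag a0) by rewrite invr_gt0 exprn_gt0.
rewrite -(ler_pM2r p0) -{1}[X in _ * X]gtr0_norm// -normrM -intE.
have iD : (lebesgue_rV d).-integrable setT (fun x => (Delta x * psi_line a0 x)%:E).
  exact: integrable_Psi_bounded DM.
apply: le_trans (le_normr_Rintegral _ iD) _ => //.
(* [W] covers both cases: near the centre the sum is at most [D], and far from it the spare factor
   [1 / (1 + |y|)] of the decay turns [M] into [M / (1 + rho)]. Its integral carries the same
   [2 ^- (d * tag a0)] as the pairing, and the two cancel. *)
pose W x := (D + M / (1 + rho)) * C * weight (2 ^+ tag a0 *: x - latt (int_of_position (tagged a0).2)).
apply: (@le_trans _ _ (\int[lebesgue_rV d]_x W x)).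
  apply: le_Rintegral => //.
  - exact: (integrable_abse iD).
  - exact: integrable_weight_affine.
  move=> x _; rewrite normrM /W -mulrA.
  set y := 2 ^+ tag a0 *: x - _ in DD *.
  have [Dx|rx] := DD x.
    apply: ler_pM => //; last exact: Psi_weight.
    by rewrite (le_trans Dx)// lerDl divr_ge0// ltW.
  apply: (@le_trans _ _ (M * (C * weight y / (1 + rho)))).
    apply: ler_pM => //; [exact: DM|apply: le_trans (PsiC _ _) _].
    rewrite ler_wpM2l ?mulr_ge0 ?weight_ge0// lef_pV2 ?posrE ?lerD2l//.
  by rewrite mulrA mulrAC ler_wpM2r ?mulr_ge0 ?weight_ge0// lerDr.
have -> : (D + M / (1 + rho)) * (C * pi ^+ d) / 2 ^+ (d * tag a0) =
    (D + M / (1 + rho)) * C * (pi ^+ d * 2 ^- (d * tag a0)) by rewrite !mulrA.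
apply: Rintegral_weight_affine_le.
by rewrite mulr_ge0// addr_ge0// divr_ge0// ltW.
Qed.

End periodized.

Lemma continuous_mulr_fun (R : realType) (T : topologicalType) (c : R) (f : T -> R) x :
  {for x, continuous f} -> {for x, continuous (fun y => c * f y)}.
Proof. by move=> cf; apply: cvgM => //; exact: cvg_cst. Qed.

Lemma continuous_prod_fun (R : realType) (T : topologicalType) (I : Type) (s : seq I)
    (f : I -> T -> R) x :
  (forall i, {for x, continuous (f i)}) ->
  {for x, continuous (fun y => \prod_(i <- s) f i y)}.
Proof.
move=> cf; elim: s => [|i s ih].
  rewrite (_ : (fun _ => _) = cst 1); first exact: cvg_cst.
  by apply/funext => y; rewrite big_nil.
rewrite (_ : (fun _ => _) = f i \* (fun y => \prod_(i <- s) f i y)).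
  by apply: cvgM; [exact: cf|exact: ih].
by apply/funext => y; rewrite big_cons.
Qed.

Lemma near_continuous_seq (R : realType) (T : topologicalType) (I : eqType) (A : seq I)
    (f : I -> T -> R) z e : 0 < e -> (forall a, {for z, continuous (f a)}) ->
  \forall x \near z, forall a, a \in A -> `|f a z - f a x| <= e.
Proof.
move=> e0 cf; elim: A => [|a A' ih]; first by apply: nearW => x a; rewrite in_nil.
have /cvgrPdist_le/(_ _ e0) ca := cf a.
by apply: filterS2 ca ih => x h1 h2 a'; rewrite in_cons => /predU1P[->//|]; exact: h2.
Qed.

(** * Test functions on the torus *)

Section bump_profile.
Context {R : realType}.

(** For [m = 0] this is the classical flat function; the negative powers of [t] make the family
    stable, up to linear combinations, under differentiation. *)
Definition bump_profile (m : nat) (t : R) : R :=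
  if 0 < t then t^-1 ^+ m * expR (- t^-1) else 0.

Lemma bump_profile_ge0 m t : 0 <= bump_profile m t.
Proof.
rewrite /bump_profile; case: ifP => // t0.
by rewrite mulr_ge0 ?expR_ge0// exprn_ge0// invr_ge0 ltW.
Qed.

Lemma bump_profile_gt0 m t : (0 < bump_profile m t) = (0 < t).
Proof.
rewrite /bump_profile; case: ifP => [t0|_]; last by rewrite ltxx.
by rewrite mulr_gt0 ?expR_gt0// exprn_gt0// invr_gt0.
Qed.

(** From the term of degree [m.+1] of the exponential series at [t^-1]. It yields flatness at 0,
    where the difference quotient of [bump_profile m] is [bump_profile m.+1]. *)
Lemma bump_profile_le m t : bump_profile m t <= (m.+1)`!%:R * `|t|.
Proof.
rewrite /bump_profile; case: ifP => [t0|_]; last by rewrite mulr_ge0.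
have it0 : 0 < t^-1 by rewrite invr_gt0.
rewrite expRN ler_pdivrMr ?expR_gt0// gtr0_norm//.
have h := expR_ge1Dxn m (ltW it0).
have f0 : (0 : R) < (m.+1)`!%:R by rewrite ltr0n fact_gt0.
have : (m.+1)`!%:R * t * (1 + t^-1 ^+ m.+1 / (m.+1)`!%:R) <= (m.+1)`!%:R * t * expR t^-1.
  by rewrite ler_wpM2l// ltW// mulr_gt0.
apply: le_trans; rewrite mulrDr mulr1.
have -> : (m.+1)`!%:R * t * (t^-1 ^+ m.+1 / (m.+1)`!%:R) = t^-1 ^+ m.
  rewrite exprSr; set F : R := _%:R in f0 *.
  by field; rewrite !gt_eqF.
by rewrite lerDr ltW// mulr_gt0.
Qed.

Lemma is_derive_bump_profile m (t : R) :
  is_derive t (1 : R) (bump_profile m) (bump_profile m.+2 t - m%:R * bump_profile m.+1 t).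
Proof.
have [t0|t0|->] := ltgtP t 0.
- have E : \forall s \near t, (cst 0 : R -> R) s = bump_profile m s.
    near=> s; rewrite /bump_profile ltNge ltW//.
    by near: s; exact: lt_nbhsl.
  have -> : bump_profile m.+2 t - m%:R * bump_profile m.+1 t = 0.
    by rewrite /bump_profile ltNge (ltW t0)/= mulr0 subrr.
  apply: DeriveDef.
    by apply: near_eq_derivable E _; exact: derivable_cst.
  by rewrite -(near_eq_derive (1 : R) E) derive_cst.
- pose f (s : R) := s^-1 ^+ m * expR (- s^-1).
  have E : \forall s \near t, f s = bump_profile m s.
    near=> s; rewrite /bump_profile ifT//.
    by near: s; exact: lt_nbhsr.
  have df : is_derive t (1 : R) f (bump_profile m.+2 t - m%:R * bump_profile m.+1 t).
    have dV : is_derive t (1 : R) (fun s : R => s^-1) (- t ^- 2 *: 1).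
      by apply: (@is_deriveV _ id); rewrite gt_eqF.
    have dN : is_derive t (1 : R) (fun s : R => - s^-1) (- (- t ^- 2 *: 1)).
      exact: is_deriveN.
    have dE : is_derive t (1 : R) (fun s : R => expR (- s^-1)) (expR (- t^-1) * (- (- t ^- 2 *: 1))).
      exact: (@is_derive1_comp _ expR (fun s => - s^-1)).
    have dX : is_derive t (1 : R) (fun s : R => s^-1 ^+ m) (m%:R * t^-1 ^+ m.-1 * - t ^- 2).
      rewrite (_ : (fun s => s^-1 ^+ m) = (fun s : R => s^-1) ^+ m); last first.
        by apply/funext => s; rewrite exprfctE.
      by apply: is_derive_eq; rewrite /GRing.scale/= mulr1.
    rewrite (_ : f = (fun s : R => s^-1 ^+ m) * (fun s : R => expR (- s^-1)))//.
    apply: is_derive_eq; rewrite /bump_profile t0 /GRing.scale/= mulr1 -exprVn.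
    rewrite opprK; case: m {dX f E} => [|m] /=; first by rewrite !mul0r mulr0 !(subr0,addr0) expr0 mul1r mulrC.
    by rewrite !exprS; ring.
  apply: DeriveDef; first exact: near_eq_derivable E _.
  by rewrite -(near_eq_derive (1 : R) E) derive_val.
- have -> : bump_profile m.+2 0 - m%:R * bump_profile m.+1 0 = 0.
    by rewrite /bump_profile ltxx mulr0 subrr.
  have cv : h^-1 *: ((bump_profile m \o shift 0) (h *: 1) - bump_profile m 0) @[h --> (0 : R)^'] --> (0 : R).
    apply/cvgrPdist_le => e e0; near=> h.
    have h0 : h != 0 by near: h; exact: nbhs_dnbhs_neq.
    rewrite /= addr0 sub0r normrN [_ *: 1]mulr1 [bump_profile m 0]/bump_profile ltxx subr0.
    have -> : h^-1 *: bump_profile m h = bump_profile m.+1 h.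
      by rewrite /bump_profile /GRing.scale/=; case: ifP => _; rewrite ?mulr0// exprS mulrA.
    rewrite ger0_norm ?bump_profile_ge0//; apply: le_trans (bump_profile_le _ _) _.
    rewrite -ler_pdivlMl ?ltr0n ?fact_gt0//.
    near: h; apply: dnbhs0_le; rewrite mulr_gt0// invr_gt0 ltr0n fact_gt0//.
  apply: DeriveDef; first exact: cvgP cv.
  exact: cvg_lim cv.
Unshelve. all: by end_near. Qed.

(* A class containing the bumps [bump_profile 0 (cos (a * t + b) - c)] and closed
   under differentiation. *)
Inductive trig_bump : (R -> R) -> Prop :=
| trig_bump_cst c : trig_bump (fun=> c)
| trig_bump_cos a b : trig_bump (fun t => cos (a * t + b))
| trig_bump_sin a b : trig_bump (fun t => sin (a * t + b))
| trig_bump_comp m a b c : trig_bump (fun t => bump_profile m (cos (a * t + b) - c))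
| trig_bump_add f g : trig_bump f -> trig_bump g -> trig_bump (fun t => f t + g t)
| trig_bump_mul f g : trig_bump f -> trig_bump g -> trig_bump (fun t => f t * g t).

Let is_derive_affine (a b t : R) : is_derive t (1 : R) (fun s => a * s + b) a.
Proof.
rewrite (_ : (fun _ => _) = (a \*: id : R -> R) + cst b)//.
by apply: is_derive_eq; rewrite addr0 /GRing.scale/= mulr1.
Qed.

Lemma trig_bump_derive f : trig_bump f ->
  exists2 f', trig_bump f' & forall t, is_derive t (1 : R) f (f' t).
Proof.
elim=> {f} [c|a b|a b|m a b c|f g _ [f' Kf' df] _ [g' Kg' dg]|f g Kf [f' Kf' df] Kg [g' Kg' dg]].
- exists (fun=> 0); first exact: trig_bump_cst.
  by move=> t; exact: is_derive_cst.
- exists (fun t => (- a) * sin (a * t + b)).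
    by apply: trig_bump_mul; [exact: trig_bump_cst|exact: trig_bump_sin].
  move=> t; rewrite mulNr mulrC -mulNr.
  exact: (@is_derive1_comp _ cos (fun t => a * t + b)).
- exists (fun t => a * cos (a * t + b)).
    by apply: trig_bump_mul; [exact: trig_bump_cst|exact: trig_bump_cos].
  by move=> t; rewrite mulrC; exact: (@is_derive1_comp _ sin (fun t => a * t + b)).
- exists (fun t => (bump_profile m.+2 (cos (a * t + b) - c) +
      (- m%:R) * bump_profile m.+1 (cos (a * t + b) - c)) * ((- a) * sin (a * t + b))).
    apply: trig_bump_mul.
      apply: trig_bump_add; first exact: trig_bump_comp.
      by apply: trig_bump_mul; [exact: trig_bump_cst|exact: trig_bump_comp].
    by apply: trig_bump_mul; [exact: trig_bump_cst|exact: trig_bump_sin].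
  move=> t; rewrite !mulNr; apply: (@is_derive1_comp _ (bump_profile m) (fun t => cos (a * t + b) - c)).
    exact: is_derive_bump_profile.
  rewrite (_ : (fun _ => _) = (fun t => cos (a * t + b)) - cst c)//.
  have d1 : is_derive t (1 : R) (fun t => cos (a * t + b)) (- sin (a * t + b) * a).
    exact: (@is_derive1_comp _ cos (fun t => a * t + b)).
  by apply: is_derive_eq; rewrite subr0 mulNr mulrC.
- exists (fun t => f' t + g' t); first exact: trig_bump_add.
  by move=> t; exact: is_deriveD.
- exists (fun t => f t * g' t + g t * f' t).
    by apply: trig_bump_add; exact: trig_bump_mul.
  by move=> t; exact: is_deriveM.
Qed.

Lemma trig_bump_continuous f : trig_bump f -> continuous f.
Proof.
move=> /trig_bump_derive[f' _ df] t.
apply/differentiable_continuous/derivable1_diffP.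
exact: (@ex_derive _ _ _ _ _ _ _ (df t)).
Qed.

(** Each factor sees one coordinate, so a partial derivative replaces one factor by its derivative
    and stays in the class; smoothness in several variables thus reduces to one variable. *)
Definition smooth_products d (f : 'rV[R]_d -> R) :=
  exists (c : R) (g : 'I_d -> R -> R), (forall i, trig_bump (g i)) /\
    f = (fun y => c * \prod_i g i (y 0 i)).

Lemma smooth_products_derive d (f : 'rV[R]_d -> R) (i : 'I_d) : smooth_products f ->
  smooth_products ('D_(delta_mx 0 i) f) /\ forall y, derivable f y (delta_mx 0 i).
Proof.
move=> [c [g [Kg ->]]].
have [g' Kg' dg] := trig_bump_derive (Kg i).
pose F (y : 'rV[R]_d) := c * \prod_i g i (y 0 i).
have cv (y : 'rV[R]_d) : h^-1 *: ((F \o shift y) (h *: delta_mx 0 i) - F y) @[h --> (0:R)^'] -->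
    g' (y 0 i) * (c * \prod_(j | j != i) g j (y 0 j)).
  have -> : (fun h => h^-1 *: ((F \o shift y) (h *: delta_mx 0 i) - F y)) =
     (fun h => h^-1 *: ((g i \o shift (y 0 i)) (h *: 1) - g i (y 0 i)) *
       (c * \prod_(j | j != i) g j (y 0 j))).
    apply/funext => h; rewrite /F /= (bigD1 i)//= [X in _ - _ * X](bigD1 i)//= !mxE !eqxx/=.
    rewrite (eq_bigr (fun j => g j (y 0 j))); last first.
      by move=> j ji; rewrite !mxE (negbTE ji) andbF mulr0 add0r.
    by rewrite /GRing.scale/=; ring.
  apply: cvgM; last exact: cvg_cst.
  have [cvi <-] := dg (y 0 i); exact: cvi.
split; last by move=> y; exact: cvgP (cv y).
exists c, (fun j => if j == i then g' else g j); split.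
  by move=> j; case: ifP.
apply/funext => y; rewrite (bigD1 i)//= eqxx.
rewrite [X in _ = _ * (_ * X)](eq_bigr (fun j => g j (y 0 j))); last by move=> j /negbTE ->.
by rewrite mulrCA; exact: cvg_lim (cv y).
Qed.

Lemma smooth_products_continuous d (f : 'rV[R]_d -> R) : smooth_products f -> continuous f.
Proof.
move=> [c [g [Kg ->]]] y; apply: (@continuous_mulr_fun _ 'rV[R]_d).
apply: (@continuous_prod_fun _ 'rV[R]_d) => i.
apply: continuous_comp; first exact: coord_continuous.
exact: trig_bump_continuous.
Qed.

Lemma smooth_products_smooth d (f : 'rV[R]_d -> R) : smooth_products f -> smooth f.
Proof.
move=> Kf s.
have Ks : smooth_products (partials s f).
  by elim: s => //= i s ih; have [] := smooth_products_derive i ih.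
split; last exact: smooth_products_continuous.
by move=> i x; have [_] := smooth_products_derive i Ks; exact.
Qed.

End bump_profile.
Lemma lebesgue_measure_itvco (R : realType) (a b : R) : a <= b ->
  lebesgue_measure (`[a, b[%classic : set (measurableTypeR R)) = (b - a)%:E.
Proof.
rewrite le_eqVlt => /predU1P[->|ab].
  by rewrite set_itvco0// measure0 subrr.
by rewrite lebesgue_measure_itv/= lte_fin ab EFinB.
Qed.

(** * Integration over the unit cube *)

Section cube.
Context {R : realType} {d : nat}.

Let I01 : set (measurableTypeR R) := `[0, 1[%classic.

Lemma indic_unit_cube (x : 'rV[R]_d) : \1_unit_cube x = \prod_i \1_I01 (x 0 i) :> R.
Proof.
have [xc|xc] := boolP (x \in unit_cube).
  rewrite indicE xc big1// => i _; rewrite indicE mem_set//.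
  by rewrite /I01/= in_itv/=; move: xc; rewrite inE; exact.
rewrite indicE (negbTE xc).
move: xc; rewrite notin_setE => /existsNP[i xi].
apply/esym/eqP; rewrite prodf_seq_eq0; apply/hasP; exists i; first exact: mem_index_enum.
by rewrite indicE memNset//= in_itv.
Qed.

Lemma measurable_unit_cube : measurable (unit_cube : set 'rV[R]_d).
Proof.
rewrite (_ : unit_cube = \bigcap_(i in [set: 'I_d])
    ((fun x : 'rV[R]_d => x 0 i : measurableTypeR R) @^-1` I01)).
  apply: fin_bigcap_measurable => [|i _]; first exact: finite_finset.
  rewrite -[X in measurable X]setTI; apply: measurable_coord => //.
  exact: measurable_itv.
apply/seteqP; split => [x xc i _|x xc i].
  by have := xc i; rewrite /I01/= in_itv.
by have := xc i Logic.I; rewrite /I01/= in_itv.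
Qed.

Lemma integral_cube_prod (f : 'I_d -> R -> R) :
  (forall i, measurable_fun setT (f i)) -> (forall i t, 0 <= f i t) ->
  (\int[lebesgue_rV d]_(x in unit_cube) (\prod_i f i (x 0 i))%:E
   = \prod_i \int[lebesgue_measure]_(t in I01) (f i t)%:E)%E.
Proof.
move=> mf f0; rewrite integral_mkcond.
under [in RHS]eq_bigr do rewrite integral_mkcond.
transitivity (\int[lebesgue_rV d]_x (\prod_i (\1_I01 (x 0 i) * f i (x 0 i)))%:E)%E.
  apply: eq_integral => x _; rewrite big_split/= -indic_unit_cube patchE indicE.
  by case: ifP => _; rewrite ?mul1r ?mul0r.
rewrite (integral_prod_coord (f := fun i t => \1_I01 t * f i t)); last 2 first.
- move=> i; apply: measurable_funM => //; apply: measurable_indic; exact: measurable_itv.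
- by move=> i t; rewrite mulr_ge0.
apply: eq_bigr => i _; apply: eq_integral => t _; rewrite patchE indicE.
by case: ifP => _; rewrite ?mul1r ?mul0r.
Qed.

Lemma lebesgue_unit_cube : lebesgue_rV d (unit_cube : set 'rV[R]_d) = 1%E.
Proof.
have := @integral_cube_prod (fun _ => cst 1) (fun _ => measurable_cst _) (fun _ _ => ler01).
under eq_integral do rewrite big1//.
rewrite integral_cst//; last exact: measurable_unit_cube.
rewrite mul1e => ->; rewrite big1// => i _.
rewrite (_ : (\int[_]_(t in I01) _)%E = (\int[lebesgue_measure]_(t in I01) cst 1 t)%E)//.
have muI01 : lebesgue_measure I01 = 1%E.
  by rewrite lebesgue_measure_itvco// subr0.
rewrite integral_cst//; last exact: measurable_itv.
by rewrite mul1e; exact: muI01.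
Qed.

Lemma integrable_cube (f : 'rV[R]_d -> R) B : measurable_fun setT f ->
  (forall x, `|f x| <= B) ->
  (lebesgue_rV d).-integrable unit_cube (EFin \o f).
Proof.
move=> mf fB; apply: measurable_bounded_integrable.
- exact: measurable_unit_cube.
- by rewrite [X in (X < _)%E]lebesgue_unit_cube ltry.
- exact: measurable_funTS.
- exists B; split; first exact: num_real.
  by move=> M BM x _ /=; rewrite (le_trans (fB x))// ltW.
Qed.

End cube.

(** * Periodic bumps and finite families of tests *)

Section bump.
Context {R : realType} {d : nat}.

Lemma cosD2pi_int (t : R) (l : int) : cos (t + l%:~R * (pi *+ 2)) = cos t.
Proof.
have nat_case n (s : R) : cos (s + n%:R * (pi *+ 2)) = cos s.
  elim: n s => [|n ih] s; first by rewrite mul0r addr0.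
  by rewrite -natr1 mulrDl mul1r addrA cosD2pi.
case: l => n; first exact: nat_case.
by rewrite NegzE mulrNz mulNr -[LHS](nat_case n.+1) subrK.
Qed.

(** After subtracting the nearest integer from [t], the angle lies in [[-pi, pi]], where the cosine
    is even, and strictly decreasing on [[0, pi]]. *)
Lemma cos_close (t r : R) : 0 <= r <= 2^-1 -> cos (2 * pi * r) <= cos (2 * pi * t) ->
  exists l : int, `|t - l%:~R| <= r.
Proof.
move=> /andP[r0 r2] ct; exists (Num.floor (t + 2^-1)).
have /andP[] := floor_itv (t + 2^-1); set l := Num.floor _; rewrite intrD => l1 l2.
set s := t - l%:~R.
have s1 : `|s| <= 2^-1 by rewrite ler_norml /s; apply/andP; split; lra.
have pi0 := pi_gt0 R.
have cs : cos (2 * pi * t) = cos (2 * pi * `|s|).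
  have -> : cos (2 * pi * `|s|) = cos (2 * pi * s).
    by have [s0|s0] := lerP 0 s; rewrite ?(ger0_norm s0)// ltr0_norm// mulrN cosN.
  rewrite -(cosD2pi_int (2 * pi * s) l); congr cos; rewrite /s -mulr_natr; ring.
rewrite leNgt; apply/negP => rs; move: ct; rewrite cs leNgt ltr_cos ?rs.
- by move=> /negP; apply; rewrite ltr_pM2l// mulr_gt0.
- rewrite in_itv/= mulr_ge0 ?mulr_ge0 ?(ltW pi0)//=; nra.
- rewrite in_itv/= mulr_ge0 ?mulr_ge0 ?(ltW pi0)//=; nra.
Qed.

(** Composing the flat profile with [cos (2 * pi * (y_i - x_i)) - cos (2 * pi * r)] makes each
    factor periodic without any sum over the lattice, and zero unless [y_i] is within [r] of [x_i]
    modulo 1. The product is then divided by its integral. *)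
Lemma bump_exists (x : 'rV[R]_d) (r : R) : 0 < r -> r <= 2^-1 ->
  exists theta : 'rV[R]_d -> R, [/\ Zd_periodic theta, smooth theta,
    forall y, 0 <= theta y, exists B, forall y, theta y <= B &
    \int[lebesgue_rV d]_(y in unit_cube) theta y = 1 /\
    forall y, closure [set z | theta z != 0] y -> exists l, `|y - x - latt l| <= r].
Proof.
move=> r0 r2.
have pi0 := pi_gt0 R.
pose c := cos (2 * pi * r).
have c1 : c < 1.
  rewrite /c -[ltRHS](cos0 R) ltr_cos; first by rewrite !mulr_gt0.
    by rewrite in_itv/= lexx ltW.
  by rewrite in_itv/= !mulr_ge0 ?(ltW pi0) ?(ltW r0)//=; nra.
pose b i t : R := bump_profile 0 (cos (2 * pi * t + - (2 * pi * x 0 i)) - c).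
have Kb i : trig_bump (b i) by exact: trig_bump_comp.
have cb i : continuous (b i) by exact: trig_bump_continuous.
have mb i : measurable_fun setT (b i) by exact: continuous_measurable_fun.
have b0 i t : 0 <= b i t by exact: bump_profile_ge0.
have b1 i t : b i t <= 1.
  rewrite /b /bump_profile; case: ifP => // h0.
  by rewrite expr0 mul1r -[leRHS]expR0 ler_expR oppr_le0 invr_ge0 ltW.
pose I01 : set (measurableTypeR R) := `[0, 1[%classic.
have mI01 : measurable I01 by exact: measurable_itv.
have muI : lebesgue_measure I01 = 1%E by rewrite lebesgue_measure_itvco// subr0.
have intb i : (0%E < \int[lebesgue_measure]_(t in I01) (b i t)%:E < +oo)%E.
  apply/andP; split; last first.
    apply: (@le_lt_trans _ _ (\int[lebesgue_measure]_(t in I01) (cst 1 t))%E).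
      apply: ge0_le_integral => //.
      - by move=> t _; rewrite lee_fin.
      - by apply/measurable_EFinP; apply: measurable_funTS; exact: mb.
      - by move=> t _; rewrite lee_fin.
    by rewrite integral_cst// mul1e [X in (X < _)%E](_ : _ = 1%E) ?ltry.
  (* At the fractional part [t0] the cosine is 1, so [b i] is positive there; it stays above half
     its value on a short interval to the right of [t0], which fits in [[0, 1[]. *)
  pose t0 := x 0 i - (Num.floor (x 0 i))%:~R.
  have /andP[f1 f2] := floor_itv (x 0 i); rewrite intrD in f2.
  pose b2 := b i t0 / 2.
  have bt0 : 0 < b i t0.
    rewrite /b bump_profile_gt0 subr_gt0 (_ : cos _ = 1)//.
    transitivity (cos (0 + (- Num.floor (x 0 i))%:~R * (pi *+ 2)) : R); last by rewrite cosD2pi_int cos0.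
    by congr cos; rewrite /t0 mulrNz; ring.
  have b20 : 0 < b2 by rewrite divr_gt0.
  have : \forall t \near t0, b2 <= b i t.
    have /cvgrPdist_le/(_ _ b20) := cb i t0.
    apply: filterS => t; rewrite ler_distlC => /andP[+ _].
    by apply: le_trans; rewrite /b2 {2}[b i t0]splitr addrK.
  move=> /nbhs_ballP[e /= e0 be].
  pose del := Num.min e (1 - t0).
  have t01 : t0 < 1 by rewrite /t0; lra.
  have del0 : 0 < del by rewrite lt_min e0 subr_gt0.
  pose J : set (measurableTypeR R) := `[t0, t0 + del[%classic.
  have mJ : measurable J by exact: measurable_itv.
  have muJ : lebesgue_measure J = del%:E.
    by rewrite lebesgue_measure_itvco ?lerDl ?ltW// addrAC subrr add0r.
  have JI : J `<=` I01.
    move=> t; rewrite /J /I01 /= !in_itv/= => /andP[h1 h2].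
    have : del <= 1 - t0 by rewrite ge_min lexx orbT.
    by rewrite /t0 in h1 h2 *; move=> h3; apply/andP; split; lra.
  have bJ t : J t -> b2 <= b i t.
    rewrite /J /= in_itv/= => /andP[h1 h2]; apply: be.
    have : del <= e by rewrite ge_min lexx.
    by move=> h3; rewrite /ball/= ler0_norm; lra.
  apply: (@lt_le_trans _ _ (\int[lebesgue_measure]_(t in J) (cst b2%:E t))%E).
    rewrite integral_cst//.
    by rewrite [X in (_ < _ * X)%E](_ : _ = del%:E) -?EFinM ?lte_fin ?mulr_gt0.
  apply: (@le_trans _ _ (\int[lebesgue_measure]_(t in J) (b i t)%:E)%E).
    apply: ge0_le_integral => //.
    - by move=> t _; rewrite lee_fin ltW.
    - by apply/measurable_EFinP; apply: measurable_funTS; exact: mb.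
  apply: ge0_subset_integral => //.
    by apply/measurable_EFinP; apply: measurable_funTS; exact: mb.
  by move=> t _; rewrite lee_fin.
pose I := \int[lebesgue_rV d]_(y in unit_cube) \prod_i b i (y 0 i).
have I0 : 0 < I.
  apply: fine_gt0; rewrite integral_cube_prod//.
  elim/big_ind: _ => [|u v /andP[u0 u1] /andP[v0 v1]|i _]; last exact: intb.
    by rewrite lte_fin ltr01 ltry.
  rewrite mule_gt0//=; apply: lte_mul_pinfty => //; first exact: ltW.
  by rewrite ge0_fin_numE// ltW.
have bp (y : 'rV[R]_d) : 0 <= \prod_i b i (y 0 i) by apply: prodr_ge0.
have bp1 (y : 'rV[R]_d) : \prod_i b i (y 0 i) <= 1 by apply: prodr_ile1 => i _; rewrite b0 b1.
have Kp : smooth_products (fun y : 'rV[R]_d => I^-1 * \prod_i b i (y 0 i)).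
  by exists I^-1, b.
exists (fun y => I^-1 * \prod_i b i (y 0 i)); split.
- move=> y l; congr (_ * _); apply: eq_bigr => i _; rewrite /b !mxE.
  rewrite -[in RHS](cosD2pi_int _ (l 0 i)); congr (bump_profile _ (cos _ - _)).
  by rewrite -mulr_natr; ring.
- exact: smooth_products_smooth.
- by move=> y; rewrite mulr_ge0// invr_ge0 ltW.
- by exists I^-1 => y; rewrite ler_piMr// invr_ge0 ltW.
split.
  rewrite RintegralZl ?mulVf ?gt_eqF//; first exact: measurable_unit_cube.
  apply: (@integrable_cube _ _ _ 1); first exact: measurable_prod_coord.
  by move=> y; rewrite ger0_norm.
move=> y cy.
have yi i : exists l : int, `|y 0 i - x 0 i - l%:~R| <= r.
  apply: cos_close; first by rewrite ltW.
  (* The inequality between cosines holds where the bump is nonzero; being closed, it extends to the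
     support. *)
  have : closed [set z : 'rV[R]_d | c <= cos (2 * pi * z 0 i + - (2 * pi * x 0 i))].
    rewrite (_ : [set _ | _] = (fun z : 'rV[R]_d => cos (2 * pi * z 0 i + - (2 * pi * x 0 i))) @^-1` [set u | c <= u])//.
    apply: closed_comp; last exact: closed_ge.
    move=> z _; apply: (@continuous_comp _ _ _ (fun z : 'rV[R]_d => z 0 i)
      (fun t => cos (2 * pi * t + - (2 * pi * x 0 i)))); first exact: coord_continuous.
    by apply: (@trig_bump_continuous _ (fun t => cos (2 * pi * t + - (2 * pi * x 0 i)))); exact: trig_bump_cos.
  move=> cl; have := closure_subset _ cy.
  move=> /(_ [set z : 'rV[R]_d | c <= cos (2 * pi * z 0 i + - (2 * pi * x 0 i))]).
  rewrite -(closure_id _).1// => /(_ _)/=; rewrite mulrBr; apply.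
  move=> z /= zn; rewrite leNgt; apply: contra zn => zc.
  rewrite mulf_eq0 invr_eq0 (gt_eqF I0)/= prodf_seq_eq0.
  apply/hasP; exists i; first exact: mem_index_enum.
  by rewrite /b /bump_profile subr_gt0 ltNge (ltW zc)/= eqxx.
have [l lP] := choice yi.
exists (\row_i l i); apply: rV_norm_le; first exact: ltW.
by move=> i; rewrite !mxE.
Qed.

(** Around each [z] in [K] the functions of [A] oscillate by at most [e / 2]; their averages against
    a bump supported there, modulo periods, are then [e]-close to their values at nearby points.
    Compactness of [K] keeps finitely many bumps. *)
Lemma finite_tests (I : eqType) (A : seq I) (f : I -> 'rV[R]_d -> R) B (U K : set 'rV[R]_d) e :
  (forall a, continuous (f a)) -> (forall a, Zd_periodic (f a)) ->
  (forall a x, `|f a x| <= B) ->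
  torus_open U -> compact K -> K `<=` U -> 0 < e ->
  exists (s : seq 'rV[R]_d) (th : 'rV[R]_d -> 'rV[R]_d -> R),
    (forall z, z \in s -> [/\ test_function U (th z), forall y, 0 <= th z y,
       exists B, forall y, th z y <= B & \int[lebesgue_rV d]_(y in unit_cube) th z y = 1]) /\
    forall x, K x -> exists2 z, z \in s & forall a, a \in A ->
       `|f a x - \int[lebesgue_rV d]_(y in unit_cube) (f a y * th z y)| <= e.
Proof.
move=> cf pf fB [oU pU] cK KU e0.
have loc z : exists rt : R * ('rV[R]_d -> R), U z -> [/\ 0 < rt.1, 
   [/\ test_function U rt.2, forall y, 0 <= rt.2 y,
       exists B, forall y, rt.2 y <= B & \int[lebesgue_rV d]_(y in unit_cube) rt.2 y = 1] &
   forall x, `|z - x| < rt.1 -> forall a, a \in A ->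
       `|f a x - \int[lebesgue_rV d]_(y in unit_cube) (f a y * rt.2 y)| <= e].
  (* A dummy value outside [U], so that the choice is defined for all [z]. *)
  have [Uz|nUz] := pselect (U z); last by exists (1, cst 0).
  pose eh := e / 2; have e2 : 0 < eh by rewrite divr_gt0.
  have : \forall x \near z, U x /\ (forall a, a \in A -> `|f a z - f a x| <= eh).
    apply: filterI; first exact: open_nbhs_nbhs.
    by apply: (@near_continuous_seq _ 'rV[R]_d) => // a; exact: cf.
  move=> /nbhs_ballP[r /= r0 zr].
  (* The support condition of [bump_exists] is a non-strict inequality, so its radius is taken
     strictly below [r]. *)
  pose r' := Num.min (r / 2) 2^-1.
  have r'0 : 0 < r' by rewrite lt_min divr_gt0//=.
  have r'r : r' < r by rewrite gt_min gtr_pMr// invf_lt1// ltr1n.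
  have [|th [pt st t0 [C tC] [It ct]]] := bump_exists z r'0; first by rewrite ge_min lexx orbT.
  have near_int y : closure [set z | th z != 0] y -> exists l, ball z r (y - latt l).
    move=> /ct[l yl]; exists l; rewrite mx_norm_ball /ball_/= distrC -addrA [- latt l + _]addrC addrA.
    exact: le_lt_trans yl _.
  exists (r, th) => _; split => //=.
    split => //; last by exists C.
    split => // y /near_int[l /zr [Uy _]].
    by rewrite -[y](subrK (latt l)) pU.
  move=> x zx a aA.
  have mfa : measurable_fun setT (f a) by exact: continuous_rV_measurable.
  have mth : measurable_fun setT th.
    by apply: continuous_rV_measurable; have [] := st [::].
  have ith : (lebesgue_rV d).-integrable unit_cube (EFin \o th).
    by apply: (integrable_cube mth (B := C)) => y; rewrite ger0_norm.
  have ifth : (lebesgue_rV d).-integrable unit_cube (EFin \o (fun y => f a y * th y)).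
    apply: (integrable_cube (B := B * C)); first exact: measurable_funM.
    by move=> y; rewrite normrM ler_pM// ger0_norm.
  have iz : (lebesgue_rV d).-integrable unit_cube (EFin \o (fun y => f a z * th y)).
    apply: (integrable_cube (B := B * C)); first exact: measurable_funM.
    by move=> y; rewrite normrM ler_pM// ger0_norm.
  have h1 : `|f a z - \int[lebesgue_rV d]_(y in unit_cube) (f a y * th y)| <= eh.
    rewrite -[f a z]mulr1 -It -RintegralZl//; last exact: measurable_unit_cube.
    rewrite -RintegralB//; last exact: measurable_unit_cube.
    have iB : (lebesgue_rV d).-integrable unit_cube (EFin \o (fun y => f a z * th y - f a y * th y)).
      have := integrableB measurable_unit_cube iz ifth.
      by under eq_fun do rewrite -EFinB.
    apply: le_trans (le_normr_Rintegral _ iB) _; first exact: measurable_unit_cube.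
    rewrite -/eh -[eh]mulr1 -It -RintegralZl//; last exact: measurable_unit_cube.
    apply: le_Rintegral; first exact: measurable_unit_cube.
    - exact: (integrable_abse iB).
    - apply: (integrable_cube (B := eh * C)); first exact: measurable_funM.
      by move=> y; rewrite normrM !ger0_norm ?(ltW e2)// ler_wpM2l// ltW.
    move=> y _; rewrite -mulrBl normrM [`|th y|]ger0_norm//.
    have [->|thy] := eqVneq (th y) 0; first by rewrite !mulr0.
    rewrite ler_wpM2r//; have /near_int[l /zr[_ /(_ _ aA)]] : closure [set z | th z != 0] y.
      exact: subset_closure.
    by rewrite -[f a y](_ : f a (y - latt l) = _)// -(pf a (y - latt l) l) subrK.
  have h2 : `|f a z - f a x| <= eh.
    by have [|_] := zr x; [rewrite mx_norm_ball|apply].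
  rewrite -(subrKA (f a z)) (le_trans (ler_normD _ _))// [e]splitr lerD//.
  by rewrite distrC.
have [rt rtP] := choice loc.
have : cover_compact K by rewrite -compact_cover.
move=> /(_ 'rV[R]_d K (fun z => ball z (rt z).1)).
case.
- by move=> z Kz; apply: ball_open; have [] := rtP z (KU _ Kz).
- by move=> z Kz; exists z => //; apply: ballxx; have [] := rtP z (KU _ Kz).
move=> D DK KD; exists (finmap.enum_fset D), (fun z => (rt z).2); split.
  move=> z zD; have := DK _ zD; rewrite inE => Kz.
  by have [_ + _] := rtP z (KU _ Kz).
move=> x /KD[z /= zD zx]; exists z => //.
have := DK _ zD; rewrite inE => Kz.
have [_ _] := rtP z (KU _ Kz); apply.
by move: zx; rewrite mx_norm_ball.
Qed.
End bump.

(** * Independence and small intervals *)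

Lemma measurable_all_norm_le d (T : measurableType d) (R : realType) (J : eqType)
    (Z : J -> T -> R) (s : seq J) (M : R) :
  (forall z, measurable_fun setT (Z z)) ->
  measurable [set w | forall z, z \in s -> `|Z z w| <= M].
Proof.
move=> mZ; elim: s => [|z s ih].
  by rewrite (_ : [set _ | _] = setT)//; apply/seteqP; split.
rewrite (_ : [set _ | _] = [set w | `|Z z w| <= M] `&`
   [set w | forall z, z \in s -> `|Z z w| <= M]).
  apply: measurableI => //.
  rewrite (_ : [set _ | _] = Z z @^-1` `[- M, M]).
    by rewrite -[X in measurable X]setTI; apply: mZ => //; exact: measurable_itv.
  by apply/seteqP; split => w /=; rewrite in_itv/= ler_norml.
apply/seteqP; split => w /= h.
  by split => [|z' z's]; apply: h; rewrite in_cons ?eqxx// z's orbT.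
by move=> z'; rewrite in_cons => /predU1P[->|]; [exact: h.1|exact: h.2].
Qed.

Section independence.
Context d (T : measurableType d) (R : realType) (P : probability T R).
Variables (I : eqType) (X : I -> T -> R).
Hypothesis mX : forall i, measurable_fun setT (X i).
Hypothesis indep : mutually_independent P X.

Let rect (s : seq I) (D : I -> set R) := \bigcap_(i in [set` s]) (X i @^-1` D i).

Let measurable_rect s D : (forall i, measurable (D i)) -> measurable (rect s D).
Proof.
move=> mD; elim: s => [|i s ih].
  by rewrite (_ : rect _ _ = setT)//; apply/seteqP; split => // w _ i.
rewrite (_ : rect _ _ = (X i @^-1` D i) `&` rect s D).
  by apply: measurableI => //; rewrite -[X in measurable X]setTI; apply: mX.
apply/seteqP; split => w /= h.
  by split => [|j js]; apply: h; rewrite /= in_cons ?eqxx// js orbT.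
by move=> j; rewrite /= in_cons => /predU1P[->|]; [exact: h.1|exact: h.2].
Qed.

(** The cylinders over the coordinates in [B]: a family stable under intersection that generates the
    sigma-algebra of the [X b], [b] in [B]. *)
Definition rectangles (B : seq I) : set (set T) :=
  [set G | exists2 D : I -> set R, forall i, measurable (D i) & G = rect B D].

(** As functions of [H], both sides are finite measures; they agree on cylinders over [B] by
    independence, hence on the sigma-algebra these generate. *)
Lemma rect_indep (A B : seq I) (D : I -> set R) (H : set T) :
  uniq (A ++ B) -> (forall i, measurable (D i)) -> <<s rectangles B >> H ->
  P (rect A D `&` H) = (P (rect A D) * P H)%E.
Proof.
move=> uAB mD HB; have mA := measurable_rect A mD.
have fA : (P (rect A D) \is a fin_num)%E by apply: fin_num_measure.
have p0 : 0 <= fine (P (rect A D)) by rewrite fine_ge0.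
have -> : P (rect A D `&` H) = mrestr P mA H by rewrite /mrestr setIC.
have -> : (P (rect A D) * P H)%E = mscale (NngNum p0) P H.
  by rewrite /mscale/= fineK.
apply: (@g_sigma_algebra_measure_unique _ _ _ (rectangles B) _ (fun=> setT)) => //.
- by move=> _ [D' mD' ->]; exact: measurable_rect.
- move=> _; exists (fun=> setT) => //.
  by apply/seteqP; split => // w _ i _.
- by rewrite bigcup_const.
- move=> _ _ [D1 mD1 ->] [D2 mD2 ->]; exists (fun i => D1 i `&` D2 i).
    by move=> i; exact: measurableI.
  apply/seteqP; split => [w [h1 h2] i iB|w h]; first by split; [exact: h1|exact: h2].
  by split => i iB; have [] := h i iB.
- move=> _ [D' mD' ->].
  change (P (rect B D' `&` rect A D) = ((fine (P (rect A D)))%:E * P (rect B D'))%E).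
  rewrite fineK//.
  pose E i := if i \in A then D i else D' i.
  have EA : rect A D = rect A E.
    by apply/seteqP; split => w h i iA; have := h i iA; rewrite /preimage /E/= iA.
  have disj i : i \in B -> i \notin A.
    move: uAB; rewrite cat_uniq => /and3P[_ /hasPn h _] iB; exact: h.
  have EB : rect B D' = rect B E.
    by apply/seteqP; split => w h i iB; have := h i iB; rewrite /preimage /E/= (negbTE (disj i iB)).
  have mE i : measurable (E i) by rewrite /E; case: ifP.
  rewrite EA EB setIC.
  have -> : rect A E `&` rect B E = rect (A ++ B) E.
    apply/seteqP; split => [w [h1 h2] i|w h].
      by rewrite /= mem_cat => /orP[]; [exact: h1|exact: h2].
    by split => i /= iA; apply: h; rewrite /= mem_cat iA ?orbT.
  move: (uAB); rewrite cat_uniq => /and3P[uA _ uB].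
  by rewrite /rect !indep// big_cat.
- move=> _; change (P (setT `&` rect A D) < +oo)%E.
  by rewrite setTI ltey_eq fA.
Qed.

Lemma measurable_rectangles (B : seq I) b : b \in B ->
  measurable_fun [set: g_sigma_algebraType (rectangles B)] (X b).
Proof.
move=> bB _ Y mY; rewrite setTI; apply: sub_sigma_algebra.
exists (fun i => if i == b then Y else setT); first by move=> i; case: ifP.
apply/seteqP; split => [w Xw i _ /=|w /(_ b bB)]; last by rewrite /preimage/= eqxx.
by rewrite /preimage/=; case: eqP => // ->.
Qed.

(* Condition on the integer parts of the contributions of [B]: on each of the
   countably many cells, the [X a], [a \in A], lie in a fixed box. *)
Lemma box_bound (J : eqType) (s : seq J) (A B : seq I) (u : J -> I -> R) (M : R)
    (r p : I -> R) :
  uniq (A ++ B) ->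
  (forall y y' : I -> R,
     (forall z, z \in s -> `|\sum_(a <- A) u z a * (y a - y' a)| <= 2 * M + 1) ->
     forall a, a \in A -> `|y a - y' a| <= r a) ->
  (forall a c, a \in A -> (P (X a @^-1` [set` `[c - r a, c + r a]%R]) <= (p a)%:E)%E) ->
  (P [set w | forall z, z \in s -> (`|\sum_(a <- A ++ B) u z a * X a w| <= M)%R] <=
    (\prod_(a <- A) p a)%:E)%E.
Proof.
move=> uAB box Pp.
set E := (X in P X).
pose Z z w := \sum_(b <- B) u z b * X b w.
pose T' := g_sigma_algebraType (rectangles B).
have mZ z : measurable_fun [set: T'] (Z z).
  suff h B' : {subset B' <= B} -> measurable_fun [set: T'] (fun w => \sum_(b <- B') u z b * X b w).
    exact: h.
  elim: B' => [_|b B' ih sB].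
    by under eq_fun do rewrite big_nil; exact: measurable_cst.
  under eq_fun do rewrite big_cons.
  apply: measurable_funD; last by apply: ih => i iB; apply: sB; rewrite in_cons iB orbT.
  apply: measurable_funM; first exact: measurable_cst.
  by apply: measurable_rectangles; apply: sB; rewrite in_cons eqxx.
pose k w : seq int := [seq Num.floor (Z z w) | z <- s].
have mk q : <<s rectangles B >> [set w | k w = q].
  rewrite -/(@measurable _ T' _) /k; elim: s q {box E k} => [|z s' ih] [|x q] /=.
  - rewrite (_ : [set _ : T | _] = setT); first exact: (@measurableT _ T').
    by apply/seteqP; split.
  - rewrite (_ : [set _ : T | _] = set0); first exact: (@measurable0 _ T').
    by apply/seteqP; split.
  - rewrite (_ : [set _ : T | _] = set0); first exact: (@measurable0 _ T').
    by apply/seteqP; split.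
  rewrite (_ : [set _ : T | _] = Z z @^-1` [set t | x%:~R <= t < (x + 1)%:~R] `&`
      [set w | [seq Num.floor (Z z w) | z <- s'] = q]).
    apply: (@measurableI _ T'); last exact: ih.
    rewrite -[X in measurable X]setTI; apply: mZ => //.
    rewrite (_ : [set _ | _] = `[x%:~R, (x + 1)%:~R[%classic); first exact: measurable_itv.
    by apply/seteqP; split => t /=; rewrite in_itv.
  apply/seteqP; split => w /=.
    by move=> [<- <-]; split => //; exact: floor_itv.
  by move=> [/floor_def-> ->].
have mE : measurable E.
  apply: (measurable_all_norm_le (Z := fun z w => \sum_(a <- A ++ B) u z a * X a w)) => z.
  by apply: measurable_sum => a; exact: measurable_funM.
have sub H : <<s rectangles B >> H -> measurable H.
  apply: (@smallest_sub _ _ (rectangles B)); first exact: sigma_algebra_measurable.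
  by move=> _ [D mD ->]; exact: measurable_rect.
have p0 a : a \in A -> 0 <= p a.
  by move=> aA; rewrite -lee_fin; apply: le_trans (Pp a 0 aA).
have pp0 : 0 <= \prod_(a <- A) p a by rewrite big_seq; apply: prodr_ge0.
have cell q : (P (E `&` [set w | k w = q]) <= (\prod_(a <- A) p a)%:E * P [set w | k w = q])%E.
  have [[w0 [Ew0 kw0]]|nw] := pselect (exists w0, E w0 /\ k w0 = q); last first.
    rewrite (_ : _ `&` _ = set0) ?measure0 ?mule_ge0//.
    by apply/seteqP; split => // w [Ew kw]; apply: nw; exists w.
  (* The box is centred at one reference point [w0] of the cell, so it is a fixed set and
     independence applies. *)
  pose D a : set R := `[X a w0 - r a, X a w0 + r a]%classic.
  have mD a : measurable (D a) by exact: measurable_itv.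
  apply: (@le_trans _ _ (P (rect A D `&` [set w | k w = q]))).
    apply: le_measure; rewrite ?inE.
    - by apply: measurableI => //; exact: (sub _ (mk _)).
    - by apply: measurableI; [exact: measurable_rect|exact: (sub _ (mk _))].
    move=> w [Ew kw]; split => // a aA; rewrite /preimage /D /= in_itv/= -ler_distlC distrC.
    have := box (fun a => X a w) (fun a => X a w0).
    move=> /(_ _ a aA); apply => z zs.
    have [Ew0z Ewz] := (Ew0 z zs, Ew z zs); rewrite !big_cat/= in Ew0z Ewz.
    (* Equal integer parts account for the [+ 1] in [2 * M + 1]; the [2 * M] comes from [w] and [w0]
       both lying in [E]. *)
    have Zz : `|Z z w - Z z w0| <= 1.
      have : Num.floor (Z z w) = Num.floor (Z z w0).
        have /eq_in_map := etrans kw (esym kw0); exact.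
      have /andP[] := floor_itv (Z z w); have /andP[] := floor_itv (Z z w0).
      rewrite intrD => h1 h2 + + E12; rewrite E12 intrD => h3 h4.
      by rewrite ler_norml; apply/andP; split; lra.
    have -> : \sum_(a <- A) u z a * (X a w - X a w0) =
        (\sum_(a <- A) u z a * X a w + Z z w) - (\sum_(a <- A) u z a * X a w0 + Z z w0)
        - (Z z w - Z z w0).
      under eq_bigr do rewrite mulrBr.
      by rewrite sumrB; ring.
    apply: le_trans (ler_normB _ _) _; apply: lerD => //.
    apply: le_trans (ler_normB _ _) _.
    by rewrite mulr_natl mulr2n lerD.
  rewrite (rect_indep _ _ (mk q))//; apply: lee_wpmul2r => //.
  move: uAB; rewrite cat_uniq => /and3P[uA _ _].
  rewrite /rect indep// -prodEFin big_seq [leRHS]big_seq.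
  suff [] : (0%E <= \prod_(i <- A | i \in A) P (X i @^-1` D i) /\
     \prod_(i <- A | i \in A) P (X i @^-1` D i) <= \prod_(i <- A | i \in A) (p i)%:E)%E by [].
  elim/big_ind2: _ => [|x1 x2 y1 y2 [? ?] [? ?]|i iA] //.
    by split; [exact: mule_ge0|exact: lee_pmul].
  by split => //; exact: Pp.
pose F n : set T := [set w | pickle (k w) = n].
have FE n : F n = if pickle_inv n is Some q then [set w | k w = q] else set0.
  case Eq : (@pickle_inv (seq int) n) => [q|]; apply/seteqP; split => w //=.
  - by rewrite /F/= => kn; move: Eq; rewrite -kn pickleK_inv => -[].
  - by move=> kq; rewrite /F/= kq; have := @pickle_invK (seq int) n; rewrite Eq.
  - by rewrite /F/= => kn; move: Eq; rewrite -kn pickleK_inv.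
have mF n : measurable (F n).
  by rewrite FE; case: pickle_inv => // q; exact: (sub _ (mk _)).
have tF : trivIset setT F by move=> m n _ _ [w [<- <-]].
have cF : \bigcup_n F n = setT by apply/seteqP; split => // w _; exists (pickle (k w)).
have EF : E = \bigcup_n (E `&` F n) by rewrite -setI_bigcupr cF setIT.
have mEF n : measurable (E `&` F n) by exact: measurableI.
rewrite EF measure_semi_bigcup//; last 2 first.
- by apply: trivIset_setIl.
- by rewrite -EF.
apply: (@le_trans _ _ (\sum_(0 <= n <oo) ((\prod_(a <- A) p a)%:E * P (F n)))%E).
  apply: lee_nneseries => [n _ //|n _]; rewrite FE.
  by case: pickle_inv => [q|]; [exact: cell|rewrite setI0 measure0; exact: mule_ge0].
rewrite nneseriesZl//.
rewrite -measure_semi_bigcup//; last by rewrite cF.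
by rewrite cF [X in (_ * X)%E](_ : _ = 1%E) ?mule1//; exact: probability_setT.
Qed.

End independence.

Section divergence.
Context (R : realType) (dim : nat) (dim_gt0 : (0 < dim)%N).
Context d (T : measurableType d) (P : probability T R) (chi : {RV P >-> R}).
Variable jn : nat -> nat.
Hypothesis jn_div : divergence_sequence dim P chi jn.

(** Strict increase from index 1 on; the successor is there because [jn 1] may be 0. *)
Lemma divergence_sequence_ge n : (0 < n)%N -> (n <= (jn n).+1)%N.
Proof.
have [inc _] := jn_div.
elim: n => // -[_ _ //|n /(_ isT) ih _].
by rewrite ltnS; apply: leq_ltn_trans (inc n.+1 n.+2 isT (leqnn _)); rewrite -ltnS.
Qed.

Let measurable_ge (c : R) : measurable [set w | c <= `|chi w|].
Proof.
rewrite (_ : [set _ | _] = (fun w => `|chi w|) @^-1` `[c, +oo[).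
  rewrite -[X in measurable X]setTI.
  have : measurable_fun setT (fun w => `|chi w|) by exact: measurableT_comp.
  by apply => //; exact: measurable_itv.
by apply/seteqP; split => w /=; rewrite in_itv/= andbT.
Qed.

(* An interval of length [2 K n^2] either avoids [|x| >= n^3], or, for large [n],
   only contains [x] with [|x| >= n]. *)
Lemma prob_interval_le (K : R) : 0 <= K -> exists N, forall n, (N <= n)%N -> forall c : R,
  (P (chi @^-1` [set` `[c - K * n%:R ^+ 2, c + K * n%:R ^+ 2]%R])
    <= (1 - 2 ^- (dim * jn n))%:E)%E.
Proof.
move=> K0; have [_ Pn] := jn_div.
pose F n := [set w | n%:R <= `|chi w|].
have cF : P (F n) @[n --> \oo] --> P (\bigcap_n F n).
  apply: nonincreasing_cvg_mu => //.
  - by apply: le_lt_trans (probability_le1 P (measurable_ge _)) _; exact: ltry.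
  - by move=> n; exact: measurable_ge.
  - by apply: bigcapT_measurable => n; exact: measurable_ge.
  - by apply/nonincreasing_seqP => n; apply/subsetPset => w; apply: le_trans; rewrite ler_nat.
have F0 : \bigcap_n F n = set0.
  apply/seteqP; split => // w /(_ (Num.truncn `|chi w|).+1 I).
  by rewrite /F/= leNgt truncnS_gt.
rewrite F0 measure0 in cF.
have [N0 _ N0P] : \forall n \near \oo, (P (F n) <= (2^-1)%:E)%E.
  have /fine_cvgP[fF /cvgrPdist_le/(_ 2^-1)] := cF.
  rewrite invr_gt0 => /(_ (ltr0n _ 2)) h.
  near=> n; have : `|0 - fine (P (F n))| <= 2^-1 by near: n.
  rewrite sub0r normrN ger0_norm ?fine_ge0// => h1.
  rewrite -[P _]fineK ?lee_fin//; by near: n.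
(* The last term gives [2 * K <= n - 1], so that [n ^ 3 - 2 * K * n ^ 2 >= n ^ 2 >= n]. With
   [n >= 2] one has [jn n >= 1], so the bound [1 / 2] from [N0] is below [1 - 2 ^- (dim * jn n)]. *)
exists (maxn N0 (maxn 2 (Num.truncn (2 * K)).+2)) => n; rewrite !geq_max => /and3P[nN0 n2 nK] c.
have n0 : (0 < n)%N by exact: leq_trans n2.
have mI : measurable (chi @^-1` [set` `[c - K * n%:R ^+ 2, c + K * n%:R ^+ 2]%R]).
  by rewrite -[X in measurable X]setTI; apply: (measurable_funP chi) => //; exact: measurable_itv.
have [[x xI x3]|nx] := pselect (exists2 x : R, c - K * n%:R ^+ 2 <= x <= c + K * n%:R ^+ 2 & n%:R ^+ 3 <= `|x|).
  apply: (@le_trans _ _ (P (F n))).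
    apply: le_measure; rewrite ?inE//; first exact: measurable_ge.
    move=> w; rewrite /preimage /F/= in_itv/= => wI.
    have nR : (1 : R) <= n%:R by rewrite ler1n.
    have KR : 2 * K <= n%:R - 1.
      apply: le_trans (ltW (truncnS_gt _)) _.
      by rewrite lerBrDr natr1 ler_nat.
    have xw : `|x - chi w| <= 2 * K * n%:R ^+ 2.
      by rewrite ler_norml; move: xI wI => /andP[? ?] /andP[? ?]; apply/andP; split; lra.
    have : `|x| <= `|chi w| + 2 * K * n%:R ^+ 2.
      by rewrite -[x in `|x|](subrK (chi w)) addrC (le_trans (ler_normD _ _))// lerD2l.
    move=> h; have {}h := le_trans x3 h.
    have : 2 * K * n%:R ^+ 2 <= (n%:R - 1) * n%:R ^+ 2 by rewrite ler_wpM2r// sqr_ge0.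
    have : n%:R <= n%:R ^+ 2 :> R by rewrite expr2 ler_peMl// ler0n.
    move=> h1 h2; rewrite exprSr in h; lra.
  apply: le_trans (N0P n nN0) _; rewrite lee_fin.
  have : (2 : R) ^- (dim * jn n) <= 2^-1.
    rewrite lef_pV2 ?posrE ?exprn_gt0// -[leLHS]expr1 ler_weXn2l ?ler1n//.
    have := divergence_sequence_ge n0; rewrite muln_gt0 dim_gt0/=.
    by move=> h; rewrite -ltnS (leq_trans n2 h).
  lra.
apply: (@le_trans _ _ (P (~` [set w | n%:R ^+ 3 <= `|chi w|]))).
  apply: le_measure; rewrite ?inE//; first exact: measurableC.
  move=> w; rewrite /preimage/= in_itv/= => wI h; apply: nx.
  by exists (chi w).
by rewrite probability_setC// EFinB leeB//; exact: Pn.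
Unshelve. all: by end_near. Qed.

End divergence.

(** * The lacunary series *)

(** The Weierstrass test with its remainder: the tail is controlled by the majorant only, hence
    uniformly over a family of series. *)
Lemma weierstrass_series (R : realType) (u m : nat -> R) :
  cvgn (series m) -> (forall j, `|u j| <= m j) ->
  cvgn (series u) /\
  forall N, `|limn (series u) - series u N| <= limn (series m) - series m N.
Proof.
move=> cm um.
have cu : cvgn (series u).
  apply: normed_cvg; apply: (series_le_cvg (v_ := m)) => //.
    by move=> n; exact: normr_ge0.
  by move=> n; exact: le_trans (um n).
split => // N.
have c1 : `|series u n - series u N| @[n --> \oo] --> `|limn (series u) - series u N|.
  by apply: cvg_norm; apply: cvgB => //; exact: cvg_cst.
have c2 : series m n - series m N @[n --> \oo] --> limn (series m) - series m N.
  by apply: cvgB => //; exact: cvg_cst.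
rewrite -(cvg_lim _ c1)// -(cvg_lim _ c2)//.
apply: ler_lim; [exact: cvgP c1|exact: cvgP c2|].
near=> n; have Nn : (N <= n)%N by near: n; exact: nbhs_infty_ge.
rewrite !sub_series_geq//; apply: le_trans (ler_norm_sum _ _ _) _.
exact: ler_sum.
Unshelve. all: by end_near. Qed.

Section lacunary.
Context (R : realType) (d : nat) (jn : nat -> nat).
Hypothesis jn_inc : forall m n, (0 < m)%N -> (m < n)%N -> (jn m < jn n)%N.
Hypothesis jn_ge : forall n, (0 < n)%N -> (n <= (jn n).+1)%N.

(** The common value of [lacunary_coefs] over all wavelets of scale [j]. *)
Definition lac (j : nat) : R :=
  \sum_(n \in [set n | (0 < n)%N /\ jn n = j]) (n%:R : R) ^- 2.

Lemma jn_inj m n : (0 < m)%N -> (0 < n)%N -> jn m = jn n -> m = n.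
Proof.
move=> m0 n0 mn; have [mn'|nm|//] := ltngtP m n.
  by have := jn_inc m0 mn'; rewrite mn ltnn.
by have := jn_inc n0 nm; rewrite mn ltnn.
Qed.

Lemma lac_jn n : (0 < n)%N -> lac (jn n) = n%:R ^- 2.
Proof.
move=> n0; rewrite /lac (_ : [set _ | _] = [set n]) ?fsbig_set1//.
apply/seteqP; split => [m [m0 mn]|m ->//].
exact: jn_inj.
Qed.

Lemma lac0 j : (forall n, (0 < n)%N -> jn n != j) -> lac j = 0.
Proof.
move=> nj; rewrite /lac (_ : [set _ | _] = set0) ?fsbig_set0//.
by apply/seteqP; split => // m [m0 mj]; have := nj m m0; rewrite mj eqxx.
Qed.

Lemma lac_ge0 j : 0 <= lac j.
Proof.
have [[n n0 <-]|nj] := pselect (exists2 n, (0 < n)%N & jn n = j).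
  by rewrite lac_jn// invr_ge0 exprn_ge0.
by rewrite lac0// => n n0; apply/eqP => nE; apply: nj; exists n.
Qed.

(** Telescoping, since [1 / (a + 1) ^ 2 <= 1 / a - 1 / (a + 1)]. *)
Let sum_inv_sqr_le J : \sum_(n < J.+1) (n.+1%:R : R) ^- 2 <= 2 - J.+1%:R^-1.
Proof.
elim: J => [|J ih]; first by rewrite big_ord1 expr1n invr1 addrK.
rewrite big_ord_recr/= (le_trans (lerD ih (lexx _)))//.
have a0 : (0 : R) < J.+1%:R by rewrite ltr0n.
rewrite -[J.+2%:R]natr1; set a : R := J.+1%:R in a0 *.
have a1 : 0 < a + 1 by rewrite addr_gt0.
have -> : 2 - (a + 1)^-1 = 2 - a^-1 + (a * (a + 1))^-1.
  by field; rewrite !gt_eqF.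
by rewrite lerD2l lef_pV2 ?posrE ?mulr_gt0 ?exprn_gt0// expr2 ler_pM2r// lerDl.
Qed.

(** The sums over scales and over [n] are exchanged: each [n] meets at most one scale, and
    [n <= jn n.+1] ensures that the indices below [J] account for all scales below [J]. *)
Lemma sum_lac_le J : \sum_(j < J) lac j <= 2.
Proof.
have E (j : 'I_J) : lac j = \sum_(n < J) (jn n.+1 == j)%:R * n.+1%:R ^- 2.
  have [[n n0 nj]|nj] := pselect (exists2 n, (0 < n)%N & jn n = j).
    rewrite -nj lac_jn//; case: n n0 nj => // n _ nj.
    have nJ : (n < J)%N.
      by apply: leq_ltn_trans (ltn_ord j); rewrite -nj -ltnS; exact: jn_ge.
    rewrite (bigD1 (Ordinal nJ))//= eqxx mul1r big1 ?addr0// => i iN.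
    case: eqP => [E|_]; last by rewrite mul0r.
    by move: iN; rewrite -val_eqE/=; have [->] := jn_inj (ltn0Sn _) (ltn0Sn _) E; rewrite eqxx.
  rewrite lac0 => [|n n0].
    by rewrite big1// => n _; case: eqP => [E|]; [case: nj; exists n.+1|rewrite mul0r].
  by apply/eqP => nE; apply: nj; exists n.
rewrite (eq_bigr _ (fun j _ => E j)) exchange_big/=.
apply: (@le_trans _ _ (\sum_(n < J) (n.+1%:R : R) ^- 2)).
  apply: ler_sum => n _; rewrite -mulr_suml ler_piMl ?invr_ge0 ?exprn_ge0//.
  have [jJ|jJ] := ltnP (jn n.+1) J.
    rewrite (bigD1 (Ordinal jJ))//= eqxx big1 ?addr0// => i iN.
    by case: eqP => // E'; move: iN; rewrite -val_eqE/= E' eqxx.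
  by rewrite big1// => i _; case: eqP => // E'; move: jJ; rewrite E' leqNgt ltn_ord.
case: J => [|J] in E *; first by rewrite big_ord0.
by apply: le_trans (sum_inv_sqr_le J) _; rewrite lerBlDr lerDl invr_ge0.
Qed.

Lemma cvg_series_lac : cvgn (series lac).
Proof.
apply: nondecreasing_is_cvgn.
  by apply/nondecreasing_seqP => n; rewrite /series/= big_nat_recr//= lerDl lac_ge0.
by exists 2 => _ [n _ <-]; rewrite /series/= big_mkord; exact: sum_lac_le.
Qed.

Variable Psi : 'I_(2 ^ d).-1 -> 'rV[R]_d -> R.
Variable C : R.
Hypothesis C0 : 0 <= C.
Hypothesis PsiC : forall i x, `|Psi i x| <= C * weight x / (1 + `|x|).
Hypothesis Psi_continuous : forall i, continuous (Psi i).

Let Bn : R := (2 ^ d).-1%:R * (C * (3 * pi) ^+ d).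

Let Bn0 : 0 <= Bn.
Proof. by rewrite !mulr_ge0// exprn_ge0// mulr_ge0// pi_ge0. Qed.

Let sum_scale_le j x :
  \sum_i \sum_k `|lacunary_coefs jn j i k : R| * `|periodized Psi j i (int_of_position k) x|
  <= lac j * Bn.
Proof.
rewrite /lacunary_coefs -/(lac j).
under eq_bigr do rewrite -mulr_sumr.
rewrite -mulr_sumr ger0_norm ?lac_ge0// ler_wpM2l ?lac_ge0//.
rewrite /Bn mulr_natl -[X in _ *+ X](card_ord (2 ^ d).-1) -sumr_const.
by apply: ler_sum => i _; exact: sum_periodized_le.
Qed.

Lemma lacunary_normally_convergent : normally_convergent Psi (lacunary_coefs jn).
Proof.
rewrite /normally_convergent.
apply: (@le_lt_trans _ _ (2 * Bn)%:E); last exact: ltry.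
have le1 j : (ereal_sup (range (fun x : 'rV[R]_d => (\sum_i \sum_k
   `|lacunary_coefs jn j i k| * `|periodized Psi j i (int_of_position k) x|)%:E)) <= (lac j * Bn)%:E)%E.
  by apply: ge_ereal_sup => _ [x _ <-]; rewrite lee_fin.
have ge0 j : (0 <= ereal_sup (range (fun x : 'rV[R]_d => (\sum_i \sum_k
   `|lacunary_coefs jn j i k| * `|periodized Psi j i (int_of_position k) x|)%:E)))%E.
  apply: le_trans (ereal_sup_ubound (ex_intro2 _ _ 0 I erefl)).
  by rewrite lee_fin; apply: sumr_ge0 => i _; apply: sumr_ge0 => k _; rewrite mulr_ge0.
apply: lime_le.
  by apply: is_cvg_nneseries => n _ _; exact: ge0.
apply: nearW => n.
apply: (@le_trans _ _ (\sum_(0 <= j < n) (lac j * Bn)%:E)%E); first exact: lee_sum.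
by rewrite sumEFin lee_fin -mulr_suml ler_wpM2r// big_mkord sum_lac_le.
Qed.

Lemma lacunary_series_continuous : continuous (series_sum Psi (lacunary_coefs jn)).
Proof.
pose u x j : R := scale_sum Psi (lacunary_coefs jn) j x.
pose m j : R := lac j * Bn.
have um x j : `|u x j| <= m j.
  apply: le_trans (sum_scale_le j x).
  apply: le_trans (ler_norm_sum _ _ _) _; apply: ler_sum => i _.
  apply: le_trans (ler_norm_sum _ _ _) _; apply: ler_sum => k _.
  by rewrite normrM.
have cm : cvgn (series m).
  rewrite (_ : series m = (fun n => series lac n * Bn)).
    by apply: is_cvgM; [exact: cvg_series_lac|exact: is_cvg_cst].
  by apply/funext => n; rewrite /series/= mulr_suml.
have partialE x J : partial_sum Psi (lacunary_coefs jn) J x = series (u x) J.+1.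
  by rewrite /series/= big_mkord.
have sumE x : series_sum Psi (lacunary_coefs jn) x = limn (series (u x)).
  have [cu _] := weierstrass_series cm (um x).
  rewrite /series_sum; under eq_fun do rewrite partialE.
  by apply/cvg_lim => //; rewrite cvg_shiftS.
move=> x; apply: cvg_approx => e e0.
have [N _ /(_ N (leqnn N)) NP] : \forall N \near \oo, `|limn (series m) - series m N| <= e.
  by have /cvgrPdist_le/(_ _ e0) := cm.
exists (fun y => series (u y) N).
  apply: continuous_sum_fun => j.
  apply: continuous_sum_fun => i; apply: continuous_sum_fun => k.
  apply: (@continuous_mulr_fun _ 'rV[R]_d).
  exact: (continuous_periodized C0 PsiC Psi_continuous).
near=> y; rewrite sumE.
have [_ /(_ N) h] := weierstrass_series cm (um y).
by apply: le_trans h _; apply: le_trans (ler_norm _) NP.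
Unshelve. all: by end_near. Qed.

End lacunary.

(** * Dyadic balls of the torus *)

Section dyadic.
Context {R : realType} {d : nat}.

Definition dyadic m (kappa : 'rV['I_(2 ^ m)]_d) : 'rV[R]_d :=
  2 ^- m *: latt (int_of_position kappa).

(** Three nested radii around the corner [dyadic kappa], in units of [2 ^- m]: the selected wavelets
    are centred within 1, [core] has radius 2, which leaves a margin to its exterior, and radius 3
    makes [core] a compact subset of an open set. Only [torus_ball] is periodic; [core] lives in
    R^d, like [psi_line]. *)
Definition torus_ball m (kappa : 'rV['I_(2 ^ m)]_d) : set 'rV[R]_d :=
  [set x | exists l, `|x - dyadic kappa - latt l| < 3 * 2 ^- m].

Definition core m (kappa : 'rV['I_(2 ^ m)]_d) : set 'rV[R]_d :=
  [set x | `|x - dyadic kappa| <= 2 * 2 ^- m].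

Lemma torus_ball_open m kappa : torus_open (@torus_ball m kappa).
Proof.
split; last first.
  move=> x l; apply/propext; split=> -[k xk].
    exists (k - l); rewrite (_ : _ - latt (k - l) = x + latt l - dyadic kappa - latt k)//.
    by apply/rowP => i; rewrite !mxE intrD mulrNz; ring.
  exists (k + l); rewrite (_ : _ - latt (k + l) = x - dyadic kappa - latt k)//.
  by apply/rowP => i; rewrite !mxE intrD; ring.
rewrite (_ : torus_ball kappa = \bigcup_l ball (dyadic kappa + latt l) (3 * 2 ^- m)).
  by apply: bigcup_open => l _; apply: ball_open; rewrite mulr_gt0// invr_gt0 exprn_gt0.
apply/seteqP; split => x [l].
  by move=> xl; exists l => //; rewrite mx_norm_ball /ball_/= distrC opprD addrA.
by move=> _; rewrite mx_norm_ball /ball_/= distrC opprD addrA => xl; exists l.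
Qed.

Lemma core_sub m kappa : @core m kappa `<=` torus_ball kappa.
Proof.
move=> x xc; exists 0; rewrite (_ : latt 0 = 0) ?subr0; last by apply/rowP => i; rewrite !mxE.
by apply: le_lt_trans xc _; rewrite ltr_pM2r ?invr_gt0 ?exprn_gt0// ltr_nat.
Qed.

Lemma core_compact m kappa : compact (@core m kappa).
Proof.
apply: bounded_closed_compact.
  exists (`|dyadic kappa| + 2 * 2 ^- m); split; first exact: num_real.
  move=> M hM x xc /=; apply/ltW/(le_lt_trans _ hM).
  rewrite -[x](subrK (dyadic kappa)) (le_trans (ler_normD _ _))// addrC lerD2l.
  exact: xc.
rewrite (_ : core kappa = (fun x : 'rV[R]_d => `|x - dyadic kappa|) @^-1` [set t | t <= 2 * 2 ^- m])//.
apply: closed_comp; last exact: closed_le.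
move=> x _; apply: (@continuous_comp _ _ _ (fun x : 'rV[R]_d => x - dyadic kappa) Num.norm).
  have := @continuous_affine _ 'rV[R]_d 1 (dyadic kappa) 0 x.
  by under eq_fun do rewrite scale1r subr0.
exact: norm_continuous.
Qed.

Lemma torus_ball_exists (U : set 'rV[R]_d) : U !=set0 -> torus_open U ->
  exists m (kappa : 'rV['I_(2 ^ m)]_d), torus_ball kappa `<=` U.
Proof.
move=> [x Ux] [oU pU].
have /nbhs_ballP[r /= r0 xr] : nbhs x U by exact: open_nbhs_nbhs.
(* Radius 3 plus 1 for the distance from [x] to the grid point below it. That point is then brought
   into the unit cube by the period [l0]. *)
have [m mr] : exists m, 4 * 2 ^- m <= r.
  have : (0 : R) < 4 / r by rewrite divr_gt0.
  pose m := (Num.truncn (4 / r)).+1; exists m.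
  rewrite ler_pdivrMr ?exprn_gt0// -ler_pdivrMl// mulrC.
  apply: le_trans (ltW (truncnS_gt _)) _.
  by rewrite -natrX ler_nat ltnW// ltn_expl.
exists m.
pose k0 := floor_mx (2 ^+ m *: x).
have m0 : (0 < 2 ^ m)%N by rewrite expn_gt0.
have kmod (i : 'I_d) : (`|((k0 (0%R : 'I_1) i) %% (2 ^ m)%N)%Z| < 2 ^ m)%N.
  have := @ltz_pmod (k0 (0%R : 'I_1) i) (2 ^ m)%N; rewrite ltz_nat m0 => /(_ isT).
  have : (0 <= k0 (0%R : 'I_1) i %% (2 ^ m)%N)%Z by apply: modz_ge0; rewrite eqz_nat -lt0n.
  by case: (_ %% _)%Z.
exists (\row_i Ordinal (kmod i)).
pose l0 : 'rV[int]_d := \row_i (k0 (0%R : 'I_1) i %/ (2 ^ m)%N)%Z.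
have k0E : k0 = int_of_position (\row_i Ordinal (kmod i)) + 2 ^+ m *: l0.
  have E2 : (2 : int) ^+ m = (2 ^ m)%N by rewrite -[2]/(2%N%:Z) -rmorphXn.
  apply/rowP => i; rewrite [RHS]mxE [X in _ + X]mxE [X in _ + _ * X]mxE [X in X + _]mxE mxE/= E2.
  rewrite gez0_abs; last by apply: modz_ge0; rewrite eqz_nat -lt0n.
  by rewrite {1}(divz_eq (k0 0 i) (2 ^ m)%N) addrC mulrC.
move: (\row_i Ordinal (kmod i)) k0E => kap k0E {kmod} y [l yl].
suff : U (y - latt l + latt l0).
  by rewrite pU => Uy; rewrite -(subrK (latt l) y) pU.
apply: xr; rewrite mx_norm_ball /ball_/=.
have xk : `|x - 2 ^- m *: latt k0| <= 2 ^- m.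
  apply: rV_norm_le => [|i]; first by rewrite invr_ge0 exprn_ge0.
  rewrite !mxE; have /andP[] := floor_itv (2 ^+ m * x 0 i).
  set z := Num.floor _; rewrite intrD => z1 z2.
  have p0 : (0 : R) < 2 ^+ m by rewrite exprn_gt0.
  have -> : x 0 i - 2 ^- m * z%:~R = 2 ^- m * (2 ^+ m * x 0 i - z%:~R).
    by rewrite mulrBr mulrA mulVf ?gt_eqF// mul1r.
  rewrite normrM gtr0_norm ?invr_gt0// ler_piMr ?invr_ge0 ?(ltW p0)//.
  by rewrite ger0_norm; lra.
have E : 2 ^- m *: latt k0 = dyadic kap + latt l0.
  apply/rowP => i; rewrite k0E /dyadic !mxE intrD intrM rmorphXn/= mulrDr mulrA.
  by rewrite mulVf ?expf_neq0// mul1r.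
have -> : x - (y - latt l + latt l0) = (x - 2 ^- m *: latt k0) -
    (y - dyadic kap - latt l).
  rewrite E; apply/rowP => i; rewrite !mxE; ring.
apply: le_lt_trans (ler_normB _ _) _.
by apply: lt_le_trans mr; lra.
Qed.

(** The descendants, at scale [j], of the dyadic cube [kappa] of scale [m]. *)
Definition box m (kappa : 'rV['I_(2 ^ m)]_d) j : {pred 'rV['I_(2 ^ j)]_d} :=
  [pred k : 'rV['I_(2 ^ j)]_d | [forall i, (k (0%R : 'I_1) i %/ 2 ^ (j - m) == kappa (0%R : 'I_1) i)%N]].

Lemma card_box m kappa j : (m <= j)%N -> (2 ^ (d * (j - m)) <= #|@box m kappa j|)%N.
Proof.
move=> mj.
have lt i (t : 'rV['I_(2 ^ (j - m))]_d) : (kappa (0%R : 'I_1) i * 2 ^ (j - m) + t (0%R : 'I_1) i < 2 ^ j)%N.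
  have : ((kappa (0%R : 'I_1) i).+1 * 2 ^ (j - m) <= 2 ^ m * 2 ^ (j - m))%N by rewrite leq_mul2r ltn_ord orbT.
  rewrite -expnD subnKC// mulSn addnC; apply: leq_trans.
  by rewrite ltn_add2l.
pose f (t : 'rV['I_(2 ^ (j - m))]_d) : 'rV['I_(2 ^ j)]_d := \row_i Ordinal (lt i t).
have fI : injective f.
  move=> t t' /rowP tt; apply/rowP => i; have := tt i; rewrite !mxE => /(congr1 val)/= /addnI.
  exact: val_inj.
have <- : #|{: 'rV['I_(2 ^ (j - m))]_d}| = (2 ^ (d * (j - m)))%N.
  by rewrite card_mx card_ord mul1n -expnM mulnC.
rewrite -(card_codom fI); apply: subset_leq_card; apply/fintype.subsetP => _ /codomP[t ->].
apply/forallP => i; rewrite mxE/= divnMDl ?expn_gt0//.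
by rewrite divn_small// addn0.
Qed.

(** A descendant has its corner within [2 ^- m] of [dyadic kappa], so outside [core] its distance to
    [x] is at least [2 ^- m]; rescaling multiplies it by [2 ^+ j]. *)
Lemma box_far m kappa j (k : 'rV['I_(2 ^ j)]_d) (x : 'rV[R]_d) : (m <= j)%N ->
  k \in @box m kappa j -> ~ core kappa x -> 2 ^+ (j - m) <= `|2 ^+ j *: x - latt (int_of_position k)|.
Proof.
move=> mj /forallP kb; rewrite /core/= => /negP; rewrite -ltNge => xc.
have j0 : (0 : R) < 2 ^+ j by rewrite exprn_gt0.
have jm : (2 : R) ^+ (j - m) = 2 ^+ j * 2 ^- m.
  by rewrite -[in RHS](subnK mj) exprD mulfK// expf_neq0.
have kk : `|2 ^- j *: latt (int_of_position k) - dyadic kappa| <= 2 ^- m.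
  apply: rV_norm_le => [|i]; first by rewrite invr_ge0 exprn_ge0.
  rewrite !mxE /=; have /eqP kd := kb i.
  have := divn_eq (k 0 i) (2 ^ (j - m)); rewrite kd => kE.
  have kr : (k (0%R : 'I_1) i %% 2 ^ (j - m) < 2 ^ (j - m))%N by rewrite ltn_mod expn_gt0.
  have -> : 2 ^- j * (k 0 i)%:Z%:~R - 2 ^- m * (kappa 0 i)%:Z%:~R =
     2 ^- j * (k (0%R : 'I_1) i %% 2 ^ (j - m))%N%:R :> R.
    rewrite {1}kE -!pmulrn natrD natrM natrX mulrDr jm [_ * (_ * _)]mulrCA !mulrA.
    by rewrite mulfVK ?gt_eqF// [_ * 2 ^- m]mulrC addrAC subrr add0r.
  rewrite ger0_norm ?mulr_ge0 ?invr_ge0 ?(ltW j0)// -ler_pdivlMl ?invr_gt0// invrK -jm.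
  by rewrite -natrX ler_nat ltnW.
rewrite (_ : 2 ^+ j *: x - _ = 2 ^+ j *: (x - 2 ^- j *: latt (int_of_position k))); last first.
  by rewrite scalerBr scalerA mulfV ?gt_eqF// scale1r.
rewrite jm normrZ gtr0_norm// ler_pM2l//.
have : `|x - dyadic kappa| <= `|x - 2 ^- j *: latt (int_of_position k)| + 2 ^- m.
  by rewrite -(subrKA (2 ^- j *: latt (int_of_position k))) (le_trans (ler_normD _ _))// lerD2l.
by move=> h; have := lt_le_trans xc h; move: (normr_ge0 x) => _ h'; apply: ltW; lra.
Qed.

End dyadic.

(** * Almost sure unboundedness *)

(** [F] is the lower limit of the [G J]: an increasing union of intersections, each contained in
    some [G J] with [J >= J0]. *)
Lemma liminf_probability_le d (T : measurableType d) (R : realType) (P : probability T R)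
    (G : nat -> set T) (J0 : nat) (e : \bar R) :
  (forall J, measurable (G J)) -> (forall J, (J0 <= J)%N -> (P (G J) <= e)%E) ->
  exists F, [/\ measurable F, (P F <= e)%E &
    forall w, (\forall J \near \oo, G J w) -> F w].
Proof.
move=> mG PG.
pose F n := \bigcap_(J in [set J | (n <= J)%N]) G J.
have mF n : measurable (F n) by apply: bigcap_measurable => //; exists n => /=.
have mbF : measurable (\bigcup_n F n) by exact: bigcupT_measurable.
exists (\bigcup_n F n); split => //.
have cF : P (F n) @[n --> \oo] --> P (\bigcup_n F n).
  apply: nondecreasing_cvg_mu => //.
  apply/nondecreasing_seqP => n; apply/subsetPset => w Fw J /= nJ.
  by apply: Fw => /=; exact: ltnW.
rewrite -(cvg_lim _ cF)//; apply: lime_le; first exact: cvgP cF.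
apply: nearW => n; apply: le_trans (PG (maxn n J0) (leq_maxr _ _)).
by apply: le_measure; rewrite ?inE// => w; apply => /=; exact: leq_maxl.
Qed.

Lemma negligible_geometric d (T : measurableType d) (R : realType) (P : probability T R)
    (E : set T) (rho : R) : 0 <= rho < 1 ->
  (forall L : nat, exists F, [/\ measurable F, (P F <= (rho ^+ L)%:E)%E & E `<=` F]) ->
  P.-negligible E.
Proof.
move=> /andP[r0 r1] /choice[F FP].
have mF : measurable (\bigcap_L F L) by apply: bigcapT_measurable => L; have [] := FP L.
exists (\bigcap_L F L); split => //; last by move=> w Ew L _; have [_ _] := FP L; exact.
apply/eqP; rewrite eq_le measure_ge0 andbT; apply/lee_addgt0Pr => e e0.
have : rho ^+ L @[L --> \oo] --> 0 by apply: cvg_expr; rewrite ger0_norm.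
move=> /cvgrPdist_le/(_ _ e0)[L _ /(_ L (leqnn L))].
rewrite sub0r normrN ger0_norm ?exprn_ge0// => Le.
rewrite add0e; have [mFL PL _] := FP L.
apply: (@le_trans _ _ (P (F L))); last by rewrite (le_trans PL)// lee_fin.
by apply: le_measure; rewrite ?inE// => w; exact.
Qed.

Lemma seq_argmax (R : realType) (I : eqType) (s : seq I) (f : I -> R) a : a \in s ->
  exists2 b, b \in s & forall c, c \in s -> f c <= f b.
Proof.
elim: s a => // x [|y s] ih a _.
  by exists x => [|c]; rewrite ?mem_seq1// => /eqP ->.
have [b bs bmax] := ih y (mem_head _ _).
have [fxb|fbx] := leP (f x) (f b).
  by exists b => [|c]; rewrite in_cons ?bs ?orbT// => /predU1P[->//|]; exact: bmax.
exists x => [|c]; first exact: mem_head.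
by rewrite in_cons => /predU1P[->//|/bmax h]; exact: le_trans h (ltW fbx).
Qed.

(** * From bounded pairings to bounded coefficients *)

Section local_bound.
Context {R : realType} {d : nat}.
Variable Psi : 'I_(2 ^ d).-1 -> 'rV[R]_d -> R.
Variable C : R.
Hypothesis C0 : 0 <= C.
Hypothesis PsiC : forall i x, `|Psi i x| <= C * weight x / (1 + `|x|).
Hypothesis Psi_continuous : forall i, continuous (Psi i).
Variable phi : 'rV[R]_d -> R.
Hypothesis Psi_basis : L2_orthonormal_basis (wavelet_family phi Psi).
Variable jn : nat -> nat.
Hypothesis jn_inc : forall m n, (0 < m)%N -> (m < n)%N -> (jn m < jn n)%N.
Hypothesis jn_ge : forall n, (0 < n)%N -> (n <= (jn n).+1)%N.
Variable i0 : 'I_(2 ^ d).-1.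
Variables (m : nat) (kappa : 'rV['I_(2 ^ m)]_d).

Definition box_indices N L : seq (wavelet_index d) :=
  [seq (existT _ (jn n) (i0, k) : wavelet_index d) | n <- iota N L, k <- enum (@box d m kappa (jn n))].

Lemma box_indicesP N L a : a \in box_indices N L ->
  exists n (k : 'rV['I_(2 ^ jn n)]_d), [/\ (N <= n < N + L)%N, k \in @box d m kappa (jn n) &
    a = existT _ (jn n) (i0, k)].
Proof.
move=> /allpairsPdep[n [k [nN kb ->]]]; exists n, k; split => //.
- by rewrite -mem_iota.
- by rewrite mem_enum in kb.
Qed.

Lemma box_indices_uniq N L : (0 < N)%N -> uniq (box_indices N L).
Proof.
move=> N0; apply: allpairs_uniq_dep.
- exact: iota_uniq.
- by move=> n _; exact: enum_uniq.
move=> a b /allpairsPdep[n [k [nN _ ->]]] /allpairsPdep[n' [k' [nN' _ ->]]] /= kk'.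
have nn' : n = n'.
  move: nN nN'; rewrite !mem_iota => /andP[nN _] /andP[nN' _].
  by apply: (jn_inj jn_inc); [exact: leq_trans nN|exact: leq_trans nN'|exact: (congr1 tag kk')].
case: _ / nn' in k' nN' kk' *.
by move: kk' => /eqP; rewrite eq_Tagged/= => /eqP[->].
Qed.

Let B : R := C * (3 * pi) ^+ d.
Let K1 : R := C * pi ^+ d.

Let B0 : 0 <= B. Proof. by rewrite mulr_ge0// exprn_ge0// mulr_ge0// pi_ge0. Qed.
Let K10 : 0 <= K1. Proof. by rewrite mulr_ge0// exprn_ge0// pi_ge0. Qed.

(** Scale by scale. The bound involves the number [L] of scales only, so [N] can grow afterwards
    without spoiling it. *)
Lemma sum_box_psi_le N L x : \sum_(a <- box_indices N L) `|psi Psi a x| <= L%:R * B.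
Proof.
rewrite big_allpairs_dep.
apply: (@le_trans _ _ (\sum_(n <- iota N L) B)); last first.
  by rewrite big_const_seq count_predT size_iota iter_addr_0 mulr_natl.
apply: ler_sum => n _; apply: le_trans (sum_periodized_le C0 PsiC (jn n) i0 x).
rewrite big_enum big_mkcond/=; apply: ler_sum => k _.
by case: ifP.
Qed.

(* The scale coefficient is included, so that the sum of the
   [coupling th a * X a] is the pairing of the random series with [th]. *)
Definition coupling (th : 'rV[R]_d -> R) a : R :=
  lac R jn (tag a) * \int[lebesgue_rV d]_(x in unit_cube) (psi Psi a x * th x).

(** With [Mx] the largest [|beta a|], [coef_bound] yields
    [Mx <= (2 * M + 1) * K1 + Mx / 4 + Mx / 4], one quarter from the tests and one from outside
    [core]; hence [Mx <= 2 * (2 * M + 1) * K1]. Dividing by [lac] returns to the coefficients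
    themselves. *)
Lemma box_tests N L (M : R) : 0 <= M -> (0 < N)%N ->
  (forall n, (N <= n)%N -> (m <= jn n)%N) ->
  (forall n, (N <= n)%N -> L%:R * B * K1 / (1 + 2 ^+ (jn n - m)) <= 4^-1) ->
  exists (s : seq 'rV[R]_d) (th : 'rV[R]_d -> 'rV[R]_d -> R),
    (forall z, z \in s -> [/\ test_function (torus_ball kappa) (th z), forall y, 0 <= th z y,
       exists B, forall y, th z y <= B & \int[lebesgue_rV d]_(y in unit_cube) th z y = 1]) /\
    forall y y' : wavelet_index d -> R,
     (forall z, z \in s ->
       `|\sum_(a <- box_indices N L) coupling (th z) a * (y a - y' a)| <= 2 * M + 1) ->
     forall a, a \in box_indices N L ->
       `|y a - y' a| <= 2 * (2 * M + 1) * K1 / lac R jn (tag a).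
Proof.
move=> M0 N0 mN LN; set A := box_indices N L.
(* Summed over [A], an error [e] per wavelet gives at most [Mx / (4 * (K1 + 1))], and [Mx / 4] after
   multiplication by [K1]. The successors avoid division by 0. *)
pose e : R := (4 * (K1 + 1) * (size A).+1%:R)^-1.
have K11 : 0 < K1 + 1 by rewrite ltr_wpDl.
have e0 : 0 < e by rewrite invr_gt0 !mulr_gt0.
have cpsi a : continuous (psi Psi a) by exact: (continuous_periodized C0 PsiC Psi_continuous).
have ppsi a : Zd_periodic (psi Psi a) by exact: periodized_periodic.
have [s [th [thP thA]]] := finite_tests A cpsi ppsi (normr_psi_le C0 PsiC)
  (torus_ball_open kappa) (@core_compact R d m kappa) (@core_sub R d m kappa) e0.
exists s, th; split => // y y' h a aA.
pose beta a := lac R jn (tag a) * (y a - y' a).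
have [a0 a0A a0max] := seq_argmax (fun a => `|beta a|) aA.
set Mx := `|beta a0| in a0max.
have Mx0 : 0 <= Mx by exact: normr_ge0.
pose D := 2 * M + 1 + Mx / (4 * (K1 + 1)).
have D0 : 0 <= D by rewrite !addr_ge0 ?mulr_ge0 ?invr_ge0 ?mulr_ge0 ?(ltW K11).
have bound1 x : `|\sum_(a <- A) beta a * psi Psi a x| <= Mx * (L%:R * B).
  apply: le_trans (ler_norm_sum _ _ _) _.
  apply: (@le_trans _ _ (\sum_(a <- A) Mx * `|psi Psi a x|)).
    rewrite big_seq [leRHS]big_seq; apply: ler_sum => b bA.
    by rewrite normrM ler_wpM2r// a0max.
  by rewrite -mulr_sumr ler_wpM2l// sum_box_psi_le.
have bound2 x : core kappa x -> `|\sum_(a <- A) beta a * psi Psi a x| <= D.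
  move=> /thA[z zs zA].
  pose I a := \int[lebesgue_rV d]_(x in unit_cube) (psi Psi a x * th z x).
  have -> : \sum_(a <- A) beta a * psi Psi a x =
      \sum_(a <- A) coupling (th z) a * (y a - y' a) + \sum_(a <- A) beta a * (psi Psi a x - I a).
    rewrite -big_split/=; apply: eq_bigr => b _; rewrite /coupling -/(I b) /beta; ring.
  apply: le_trans (ler_normD _ _) _; apply: lerD; first exact: h.
  apply: le_trans (ler_norm_sum _ _ _) _.
  apply: (@le_trans _ _ (\sum_(b <- A) Mx * e)).
    rewrite big_seq [leRHS]big_seq; apply: ler_sum => b bA.
    by rewrite normrM ler_pM// ?a0max//; exact: zA.
  rewrite big_const_seq count_predT iter_addr_0 -mulrnAr ler_wpM2l//.
  rewrite /e invfM -[leRHS]mulr1 -mulr_natr -mulrA ler_wpM2l ?invr_ge0 ?mulr_ge0 ?(ltW K11)//.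
  by rewrite ler_pdivrMl ?mulr1 ?ler_nat.
have [n [k [/andP[Nn _] kb a0E]]] := box_indicesP a0A.
have := coef_bound (rho := 2 ^+ (jn n - m)) C0 PsiC Psi_continuous Psi_basis
  (box_indices_uniq L N0) a0A D0 _ bound1.
rewrite exprn_ge0// => /(_ isT).
have far x : `|\sum_(a <- A) beta a * psi Psi a x| <= D \/
     2 ^+ (jn n - m) <= `|2 ^+ tag a0 *: x - latt (int_of_position (tagged a0).2)|.
  have [cx|cx] := pselect (core kappa x); first by left; exact: bound2.
  by right; rewrite a0E/=; apply: box_far kb cx; exact: mN.
move=> /(_ far); rewrite -/Mx -/K1 => MxD.
have MxK : Mx <= 2 * (2 * M + 1) * K1.
  have h1 : Mx * (L%:R * B) / (1 + 2 ^+ (jn n - m)) * K1 <= Mx / 4.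
    rewrite (_ : _ * K1 = Mx * (L%:R * B * K1 / (1 + 2 ^+ (jn n - m)))) ?ler_wpM2l ?LN//.
    ring.
  have h2 : Mx / (4 * (K1 + 1)) * K1 <= Mx / 4.
    rewrite invfM !mulrA -[leRHS]mulr1 -!mulrA ler_wpM2l// ler_wpM2l ?invr_ge0//.
    by rewrite ler_pdivrMl// mulr1 lerDl.
  by move: MxD; rewrite mulrDl {1}/D mulrDl; lra.
have [n' [k' [/andP[Nn' _] _ aE]]] := box_indicesP aA.
have la : 0 < lac R jn (tag a).
  by rewrite aE/= (lac_jn _ jn_inc) ?invr_gt0 ?exprn_gt0 ?ltr0n// (leq_trans N0).
rewrite ler_pdivlMr// -[X in _ * X]gtr0_norm// -normrM mulrC.
exact: le_trans (a0max a aA) MxK.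
Qed.

(** Each factor is at most [expR (- 2 ^- (d * jn n))]; at every scale the exponents add up to at
    most [- 2 ^- (d * m)], whatever [n]. *)
Lemma prod_box_le N L : (forall n, (N <= n)%N -> (m <= jn n)%N) ->
  \prod_(a <- box_indices N L) (1 - 2 ^- (d * tag a) : R) <= expR (- 2 ^- (d * m)) ^+ L.
Proof.
move=> mN; rewrite big_allpairs_dep.
apply: (@le_trans _ _ (\prod_(n <- iota N L) expR (- 2 ^- (d * m)))); last first.
  by rewrite big_const_seq count_predT size_iota iter_mulr_1.
rewrite big_seq [leRHS]big_seq; apply: ler_prod => n; rewrite mem_iota => /andP[Nn _] /=.
have q1 : (2 : R) ^- (d * jn n) <= 1 by rewrite invf_le1 ?exprn_gt0// exprn_ege1// ler1n.
have q0 : 0 <= (2 : R) ^- (d * jn n) by rewrite invr_ge0 exprn_ge0.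
rewrite prodr_ge0/=; last by move=> *; rewrite subr_ge0.
apply: (@le_trans _ _ (\prod_(k <- enum (@box d m kappa (jn n))) expR (- 2 ^- (d * jn n) : R))).
  by apply: ler_prod => k _; rewrite subr_ge0 q1/= expR_ge1Dx.
rewrite big_const_seq count_predT -cardE iter_mulr_1 -expRM_natl ler_expR.
rewrite mulrN lerN2 -ler_pdivrMr ?invr_gt0 ?exprn_gt0// invrK.
have -> : (2 : R) ^- (d * m) * 2 ^+ (d * jn n) = (2 ^ (d * (jn n - m)))%N%:R.
  rewrite -[in LHS](subnK (mN n Nn)) mulnDr exprD natrX mulrC mulfK// expf_neq0.
by rewrite ler_nat card_box// mN.
Qed.

Definition indices_upto J : seq (wavelet_index d) :=
  [seq (existT _ j ik : wavelet_index d) | j <- iota 0 J.+1, ik <- enum {: 'I_(2 ^ d).-1 * 'rV['I_(2 ^ j)]_d}].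

Lemma mem_indices_upto J a : (a \in indices_upto J) = (tag a <= J)%N.
Proof.
apply/idP/idP => [/allpairsPdep[j [ik [jJ _ ->]]]|aJ].
  by rewrite mem_iota in jJ.
case: a aJ => j ik /= jJ; apply/allpairsPdep; exists j, ik; split => //.
- by rewrite mem_iota.
- by rewrite mem_enum.
Qed.

Lemma indices_upto_uniq J : uniq (indices_upto J).
Proof.
apply: allpairs_uniq_dep; first exact: iota_uniq.
  by move=> n _; exact: enum_uniq.
by move=> [j ik] [j' ik'] _ _.
Qed.

Lemma sum_indices_upto J (F : wavelet_index d -> R) :
  \sum_(a <- indices_upto J) F a = \sum_(j < J.+1) \sum_i \sum_k F (existT _ (j : nat) (i, k)).
Proof.
rewrite big_allpairs_dep/=.
rewrite -(big_mkord xpredT (fun j => \sum_i \sum_k F (existT _ j (i, k)))) /index_iota subn0.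
apply: eq_bigr => j _; rewrite pair_big/= big_enum/=.
by apply: eq_bigr => -[i k] _.
Qed.

Lemma integral_partial_sum (c : wavelet_coefs R d) J (th : 'rV[R]_d -> R) :
  measurable_fun setT th -> (exists B, forall x, `|th x| <= B) ->
  \int[lebesgue_rV d]_(x in unit_cube) (partial_sum Psi (fun j i k => lacunary_coefs jn j i k * c j i k) J x * th x)
  = \sum_(a <- indices_upto J) coupling th a * c (tag a) (tagged a).1 (tagged a).2.
Proof.
move=> mth [Bt thB].
have ip a : (lebesgue_rV d).-integrable unit_cube (EFin \o (fun x => psi Psi a x * th x)).
  apply: (integrable_cube (B := B * Bt)).
    by apply: measurable_funM => //; exact: measurable_psi C0 PsiC Psi_continuous a.
  by move=> x; rewrite normrM ler_pM// (normr_psi_le C0 PsiC).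
pose c' (a : wavelet_index d) := lac R jn (tag a) * c (tag a) (tagged a).1 (tagged a).2.
transitivity (\int[lebesgue_rV d]_(x in unit_cube) (\sum_(a <- indices_upto J) c' a * (psi Psi a x * th x))).
  apply: eq_Rintegral => x _; rewrite sum_indices_upto mulr_suml.
  apply: eq_bigr => j _; rewrite mulr_suml; apply: eq_bigr => i _.
  by rewrite mulr_suml; apply: eq_bigr => k _; rewrite mulrA.
rewrite Rintegral_sum//; last 2 first.
- exact: measurable_unit_cube.
- move=> a; rewrite (_ : EFin \o _ = (fun x => (c' a)%:E * (psi Psi a x * th x)%:E)%E)//.
  exact: (integrableZl measurable_unit_cube (c' a) (ip a)).
apply: eq_bigr => a _; rewrite RintegralZl//; last exact: measurable_unit_cube.
by rewrite /c' /coupling; ring.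
Qed.

End local_bound.

(** A nonnegative test of integral 1 is a probability density on the cube, so a pairing with it is
    at most the essential supremum of [g] on [U]. *)
Lemma essentially_bounded_pairing (R : realType) d (g : 'rV[R]_d -> R) (U : set 'rV[R]_d) :
  g \_ U \in Lfun (lebesgue_rV d) +oo%E ->
  exists2 C : R, 0 <= C & forall th : 'rV[R]_d -> R, measurable_fun setT th ->
    (forall x, 0 <= th x) -> (exists B, forall x, th x <= B) ->
    \int[lebesgue_rV d]_(x in unit_cube) th x = 1 ->
    `|\int[lebesgue_rV d]_(x in unit_cube `&` U) (g x * th x)| <= C.
Proof.
move=> gU; have mg : measurable_fun setT (g \_ U) by have := sub_Lfun_mfun gU; rewrite inE.
have := sub_Lfun_finLfun gU; rewrite inE /= /finite_norm unlock.
(* The norm of exponent [+oo] is an essential supremum only when the whole space has positive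
   measure. *)
have mu0 : (0 < lebesgue_rV d [set: 'rV[R]_d])%E.
  apply: (@lt_le_trans _ _ (lebesgue_rV d (unit_cube : set 'rV[R]_d))).
    by rewrite [X in (_ < X)%E]lebesgue_unit_cube.
  apply: le_measure; rewrite ?inE//; exact: measurable_unit_cube.
rewrite mu0; set s := ess_sup _ _ => fin.
(* The maximum with 0 excludes [-oo] and makes the bound a nonnegative real. *)
pose C := fine (maxe s 0).
have C0 : 0 <= C by rewrite fine_ge0// le_max lexx orbT.
have CE : C%:E = maxe s 0.
  by rewrite fineK// ge0_fin_numE ?le_max ?lexx ?orbT// gt_max fin ltry.
have /ess_supP gC : (s <= C%:E)%E by rewrite CE le_max lexx.
exists C => // th mth th0 [B thB] th1.
have mth' : measurable_fun unit_cube (EFin \o th) by apply/measurable_EFinP; exact: measurable_funTS.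
rewrite Rintegral_mkcondr; set f := _ \_ U.
have fE : f = (fun x => (g \_ U) x * th x).
  by apply/funext => x; rewrite /f !patchE; case: ifP => // _; rewrite mul0r.
have mf : measurable_fun unit_cube (EFin \o f).
  by apply/measurable_EFinP; apply: measurable_funTS; rewrite fE; exact: measurable_funM.
suff : (`|\int[lebesgue_rV d]_(x in unit_cube) (f x)%:E| <= C%:E)%E.
  by rewrite /Rintegral; case: (integral _ _ _) => [r| |] //=; rewrite normr0.
apply: le_trans (le_abse_integral _ measurable_unit_cube mf) _.
apply: (@le_trans _ _ (\int[lebesgue_rV d]_(x in unit_cube) (C%:E * (th x)%:E))%E).
  apply: ae_ge0_le_integral => //.
  - exact: measurable_unit_cube.
  - exact: measurableT_comp.
  - by move=> x _; rewrite mule_ge0// lee_fin.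
  - exact: measurable_funeM.
  case: gC => N [mN N0 sN]; exists N; split => // x /= nx; apply: sN => /= gx; apply: nx => _.
  by rewrite fE normrM [`|th x|]ger0_norm// -EFinM lee_fin ler_wpM2r// -lee_fin.
rewrite ge0_integralZl//; last 2 first.
- exact: measurable_unit_cube.
- by move=> x _; rewrite lee_fin.
suff -> : (\int[lebesgue_rV d]_(x in unit_cube) (th x)%:E = 1)%E by rewrite mule1.
rewrite -[LHS]fineK ?[fine _]th1//; apply: integrable_fin_num.
  exact: measurable_unit_cube.
by apply: (integrable_cube mth (B := B)) => x; rewrite ger0_norm.
Qed.

Lemma near_all_seq (I : eqType) (s : seq I) (Q : I -> nat -> Prop) :
  (forall z, z \in s -> \forall J \near \oo, Q z J) ->
  \forall J \near \oo, forall z, z \in s -> Q z J.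
Proof.
elim: s => [|z s ih] h; first exact: nearW.
have h1 : \forall J \near \oo, Q z J by apply: h; rewrite mem_head.
have h2 : \forall J \near \oo, forall z, z \in s -> Q z J.
  by apply: ih => z' z's; apply: h; rewrite in_cons z's orbT.
near=> J => z'; rewrite in_cons => /predU1P[->|].
  by near: J.
by move: z'; near: J.
Unshelve. all: by end_near. Qed.

(** * Negligibility of local boundedness *)

Section almost_surely.
Context {R : realType} {d : nat}.
Hypothesis d_gt0 : (0 < d)%N.
Variable Psi : 'I_(2 ^ d).-1 -> 'rV[R]_d -> R.
Variable C : R.
Hypothesis C0 : 0 <= C.
Hypothesis PsiC : forall i x, `|Psi i x| <= C * weight x / (1 + `|x|).
Hypothesis Psi_continuous : forall i, continuous (Psi i).
Variable phi : 'rV[R]_d -> R.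
Hypothesis Psi_basis : L2_orthonormal_basis (wavelet_family phi Psi).
Context d0 (T0 : measurableType d0) (P0 : probability T0 R) (chi : {RV P0 >-> R}).
Variable jn : nat -> nat.
Hypothesis jn_div : divergence_sequence d P0 chi jn.
Context d1 (T1 : measurableType d1) (P : probability T1 R).
Variable X : forall j : nat, 'I_(2 ^ d).-1 -> 'rV['I_(2 ^ j)]_d -> {RV P >-> R}.
Arguments X : clear implicits.
Hypothesis iidX : iid_copies chi X.

Let jn_inc : forall m n, (0 < m)%N -> (m < n)%N -> (jn m < jn n)%N := jn_div.1.
Let jn_ge : forall n, (0 < n)%N -> (n <= (jn n).+1)%N := divergence_sequence_ge jn_div.

Let randomized w := partial_sum Psi (fun j i k => lacunary_coefs jn j i k * X j i k w).

(** Local boundedness freed of [U] and [g]: the bound [M] is common to all normalized tests, and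
    only the threshold on [J] depends on the test. The tests are uncountably many, so the set is
    covered by measurable ones, each built from finitely many tests. *)
Definition bounded_near m (kappa : 'rV['I_(2 ^ m)]_d) (M : R) : set T1 :=
  [set w | forall th, test_function (torus_ball kappa) th -> (forall y, 0 <= th y) ->
     (exists B, forall y, th y <= B) ->
     \int[lebesgue_rV d]_(y in unit_cube) th y = 1 ->
     \forall J \near \oo,
       `|\int[lebesgue_rV d]_(y in unit_cube) (randomized w J y * th y)| <= M].

Lemma test_function_measurable U (th : 'rV[R]_d -> R) :
  test_function U th -> measurable_fun setT th.
Proof. by move=> [_ sth _]; apply: continuous_rV_measurable; have [] := sth [::]. Qed.

Lemma negligible_bounded_near m (kappa : 'rV['I_(2 ^ m)]_d) (M : R) : 0 <= M ->
  P.-negligible (bounded_near kappa M).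
Proof.
move=> M0; pose rho : R := expR (- 2 ^- (d * m)).
have rho1 : 0 <= rho < 1.
  by rewrite expR_ge0/= expR_lt1 oppr_lt0 invr_gt0 exprn_gt0.
apply: (negligible_geometric rho1) => L.
have i0 : 'I_(2 ^ d).-1.
  have : (0 < (2 ^ d).-1)%N by rewrite -ltnS prednK ?expn_gt0// -{1}(expn0 2) ltn_exp2l.
  by case: (2 ^ d).-1 => // n _; exact: ord0.
pose B : R := C * (3 * pi) ^+ d.
pose K1 : R := C * pi ^+ d.
have B0 : 0 <= B by rewrite mulr_ge0// exprn_ge0// mulr_ge0// pi_ge0.
have K10 : 0 <= K1 by rewrite mulr_ge0// exprn_ge0// pi_ge0.
pose Kc := 2 * (2 * M + 1) * K1.
have Kc0 : 0 <= Kc by apply: mulr_ge0 => //; apply: mulr_ge0 => //; rewrite addr_ge0// mulr_ge0.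
have [N1 N1P] := prob_interval_le d_gt0 jn_div Kc0.
(* Beyond [N] one has [jn n - m > q], so [2 ^+ (jn n - m)] exceeds [4 * L * B * K1]; the [.+2] below
   makes up for the successor in [jn_ge]. *)
pose q := Num.truncn (4 * (L%:R * B * K1)).
pose N := maxn (maxn 1 N1) (m + q).+2.
have N0 : (0 < N)%N by rewrite /N !leq_max.
have jN n : (N <= n)%N -> (m + q < jn n)%N.
  rewrite geq_max => /andP[_ mq]; have := jn_ge (leq_trans (ltn0Sn _) mq).
  by move=> h; have := leq_trans mq h.
have mN n : (N <= n)%N -> (m <= jn n)%N.
  by move=> /jN /ltnW; apply: leq_trans; exact: leq_addr.
have LN n : (N <= n)%N -> L%:R * B * K1 / (1 + 2 ^+ (jn n - m)) <= 4^-1.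
  move=> /jN h; have p0 : (0 : R) < 1 + 2 ^+ (jn n - m) by rewrite ltr_pwDl ?exprn_ge0.
  rewrite ler_pdivrMr// ler_pdivlMl//; apply: le_trans (ltW (truncnS_gt _)) _.
  rewrite -/q (@le_trans _ _ (jn n - m)%N%:R)//.
    by rewrite ler_nat ltn_subRL.
  by rewrite -natrX addrC natr1 ler_nat ltnW// ltnS ltnW// ltn_expl.
have [s [th [thP box]]] :=
  box_tests C0 PsiC Psi_continuous Psi_basis jn_inc i0 kappa M0 N0 mN LN.
pose Y (a : wavelet_index d) : T1 -> R := X (tag a) (tagged a).1 (tagged a).2.
have mY a : measurable_fun setT (Y a) by exact: measurable_funP.
pose u z a := coupling Psi jn (th z) a.
pose G J := [set w | forall z, z \in s -> `|\sum_(a <- indices_upto J) u z a * Y a w| <= M].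
have mG J : measurable (G J).
  apply: measurable_all_norm_le => z; apply: measurable_sum => a.
  exact: measurable_funM.
pose A := box_indices jn i0 kappa N L.
have PG J : (jn (N + L) <= J)%N -> (P (G J) <= (rho ^+ L)%:E)%E.
  (* For such [J] the partial sum contains all of [A]. The indices in [BJ] grow in number with [J],
     but the bound of [box_bound] does not depend on them. *)
  move=> jJ; pose BJ := [seq a <- indices_upto J | a \notin A].
  have uA : uniq A by exact: box_indices_uniq.
  have uAB : uniq (A ++ BJ).
    rewrite cat_uniq uA filter_uniq ?indices_upto_uniq// andbT/=.
    by apply/hasPn => a; rewrite mem_filter => /andP[].
  have AB : perm_eq (indices_upto J) (A ++ BJ).
    apply: uniq_perm => //; first exact: indices_upto_uniq.
    move=> a; rewrite [RHS]mem_cat mem_filter; have [aA|//] := boolP (a \in A).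
    rewrite mem_indices_upto; have [n [k [/andP[Nn nNL] _ ->]]] := box_indicesP aA.
    by apply: leq_trans jJ; rewrite ltnW//=; apply: jn_inc => //; exact: leq_trans Nn.
  have -> : G J = [set w | forall z, z \in s -> `|\sum_(a <- A ++ BJ) u z a * Y a w| <= M].
    by apply/seteqP; split => w Gw z zs; have := Gw z zs; rewrite (perm_big _ AB).
  apply: (@le_trans _ _ (\prod_(a <- A) (1 - 2 ^- (d * tag a)))%:E); last first.
    by rewrite lee_fin; exact: prod_box_le.
  apply: (box_bound mY iidX.2 uAB box) => a c /box_indicesP[n [k [/andP[Nn _] _ aE]]].
  have n0 : (0 < n)%N by exact: leq_trans Nn.
  have mI : measurable [set` `[c - 2 * (2 * M + 1) * K1 / lac R jn (tag a), c + 2 * (2 * M + 1) * K1 / lac R jn (tag a)]%R].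
    exact: measurable_itv.
  have := iidX.1 (tag a) (tagged a).1 (tagged a).2 _ mI.
  rewrite /distribution/= /pushforward => ->.
  (* Dividing by [lac], which is [n ^- 2] at scale [jn n], gives an interval of half-length
     [Kc * n ^ 2]. *)
  rewrite aE /= (lac_jn _ jn_inc)// invrK; apply: N1P.
  by move: Nn; rewrite !geq_max => /andP[/andP[]].
have [F [mF PF FG]] := liminf_probability_le mG PG.
exists F; split => // w Ew; apply: FG; apply: near_all_seq => z zs.
have [tz tz0 [Bz tzB] tz1] := thP z zs.
have := Ew (th z) tz tz0 (ex_intro _ Bz tzB) tz1.
apply: filterS => J; rewrite /randomized (integral_partial_sum C0 PsiC Psi_continuous)//.
  exact: test_function_measurable tz.
by exists Bz => x; rewrite ger0_norm.
Qed.

(** A test supported in a dyadic ball inside [U] is also a test for [U], so boundedness on some [U]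
    puts [w] in one of countably many negligible sets, indexed by a dyadic ball and an integer
    bound. *)
Lemma nowhere_locally_bounded_ae :
  {ae P, forall w, nowhere_locally_bounded Psi
     (fun j i k => lacunary_coefs jn j i k * X j i k w)}.
Proof.
pose E (q : {m : nat & 'rV['I_(2 ^ m)]_d} * nat) := bounded_near (tagged q.1) q.2%:R.
pose F n := if @pickle_inv ({m : nat & 'rV['I_(2 ^ m)]_d} * nat)%type n is Some q then E q else set0.
apply: (@negligibleS _ _ _ _ (\bigcup_n F n)); last first.
  apply: negligible_bigcup => n; rewrite /F; case: pickle_inv => [q|]; last exact: negligible_set0.
  exact: negligible_bounded_near.
move=> w /= /contrapT[U [U0 tU [g [pg gU cg]]]].
have [m [kappa kU]] := torus_ball_exists U0 tU.
have [M M0 gM] := essentially_bounded_pairing gU.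
(* One unit rounds [M] up to an integer, the other absorbs the distance from the partial sums to
   their limit. *)
pose q : {m : nat & 'rV['I_(2 ^ m)]_d} * nat := (existT _ m kappa, (Num.truncn M).+2).
exists (pickle q) => //; rewrite /F pickleK_inv => th tth th0 thB th1.
have tthU : test_function U th by case: tth => p1 p2 p3; split => //; exact: subset_trans kU.
have gth := gM th (test_function_measurable tth) th0 thB th1.
have /cvgrPdist_le/(_ 1 ltr01) := cg th tthU.
apply: filterS => J; rewrite /q/= => h.
rewrite -[X in `|X|](subrK (\int[lebesgue_rV d]_(x in unit_cube `&` U) (g x * th x))).
apply: le_trans (ler_normD _ _) _.
rewrite -natr1 addrC lerD//; last by rewrite distrC.
by rewrite (le_trans gth)// ltW// truncnS_gt.
Qed.

End almost_surely.

Theorem proposition3p1 (R : realType) (d : nat) (d_gt0 : (0 < d)%N)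
    (phi : 'rV[R]_d -> R) (Psi : 'I_(2 ^ d).-1 -> 'rV[R]_d -> R)
    (Psi_basis : smooth_wavelet_basis 0 phi Psi)
    (Psi_continuous : forall i, continuous (Psi i))
    (d0 : measure_display) (T0 : measurableType d0) (P0 : probability T0 R)
    (chi : {RV P0 >-> R}) (chi_unbounded : unbounded_rv P0 chi)
    (jn : nat -> nat) (jn_divergence : divergence_sequence d P0 chi jn) :
  [/\ normally_convergent Psi (lacunary_coefs jn),
      continuous (series_sum Psi (lacunary_coefs jn)) &
      forall (d1 : measure_display) (T1 : measurableType d1)
        (P : probability T1 R)
        (X : forall j : nat, 'I_(2 ^ d).-1 -> 'rV['I_(2 ^ j)]_d ->
          {RV P >-> R}),
        iid_copies chi X ->
        {ae P, forall w, nowhere_locally_bounded Psi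
          (fun j i k => lacunary_coefs jn j i k * X j i k w)}].
Proof.
have [_ decay basis] := Psi_basis.
have [C C0 PsiC] : exists2 C : R, 0 <= C &
    forall i x, `|Psi i x| <= C * weight x / (1 + `|x|).
  have /choice[c cP] i : exists c : R, 0 <= c /\ forall x, `|Psi i x| <= c * weight x / (1 + `|x|).
    have := fast_decay_weight ((decay i).2 [::] isT).
    by move=> [c c0 cP]; exists c.
  exists (\sum_i c i) => [|i x]; first by apply: sumr_ge0 => i _; exact: (cP i).1.
  apply: le_trans ((cP i).2 x) _.
  rewrite -!mulrA ler_wpM2r//.
    by rewrite mulr_ge0 ?weight_ge0// invr_ge0 addr_ge0.
  by rewrite (bigD1 i)//= lerDl; apply: sumr_ge0 => j _; exact: (cP j).1.
have [jn_inc _] := jn_divergence.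
have jn_ge := divergence_sequence_ge jn_divergence.
split.
- exact: lacunary_normally_convergent jn_inc jn_ge _ _ C0 PsiC.
- exact: lacunary_series_continuous jn_inc jn_ge _ _ C0 PsiC Psi_continuous.
- move=> d1 T1 P X iidX.
  have h := nowhere_locally_bounded_ae d_gt0 C0 PsiC Psi_continuous basis jn_divergence iidX.
  exact: h.
Qed.
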